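(* Let $d > 3$ be an integer and let $\psi = (\psi_i)_{1 \le i \le d}$ be a $d$-dimensional permanental vector with kernel $G = (G(i,j))_{1 \le i,j \le d}$ and some index $\beta > 0$. Assume that there exists at most one subset $I \subset \{1, \dots, d\}$ of three indexes such that the principal submatrix $G_{I \times I} = (G(i,j))_{(i,j) \in I \times I}$ is symmetrizable. Then $\psi$ is infinitely divisible.
   Context: A real-valued, nonnegative random vector $\psi = (\psi_i)_{1 \le i \le n}$ is a permanental vector with kernel $G = (G(i,j))_{1 \le i,j \le n}$ (a real $n\times n$ matrix) and index $\beta > 0$ if for every $(\alpha_1, \dots, \alpha_n) \in \mathbb{R}_+^n$, $$\mathbb{E}\Big[\exp\Big\{-\tfrac12 \sum_{i=1}^n \alpha_i \psi_i\Big\}\Big] = |I + \alpha G|^{-\beta},$$ where $I$ is the $n\times n$ identity matrix, $\alpha = \mathrm{Diag}((\alpha_i)_{1\le i\le n})$, and $|\cdot|$ denotes the determinant. Two $m\times m$ real matrices $A$ and $B$ are effectively equivalent if $|I + xA| = |I + xB|$ for every diagonal matrix $x = \mathrm{Diag}(x_1,\dots,x_m)$ with $(x_1,\dots,x_m) \in \mathbb{R}^m$. A square matrix is symmetrizable if it is effectively equivalent to a symmetric matrix. A random vector $\psi$ is infinitely divisible if for every integer $k \ge 1$ there exist i.i.d. random vectors $\psi^{(1)}, \dots, \psi^{(k)}$ with $\psi^{(1)} + \dots + \psi^{(k)}$ equal in law to $\psi$. *)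

(* Defs.v *)
From HB Require Import structures.
From mathcomp Require Import all_boot all_order all_algebra.
From mathcomp Require Import all_classical all_reals all_analysis.
Set Implicit Arguments. Unset Strict Implicit. Unset Printing Implicit Defensive.
Import Order.TTheory GRing.Theory Num.Theory.
Local Open Scope classical_set_scope.
Local Open Scope ring_scope.

Section Defs.
Variable R : realType.

(* Borel (= product) sigma-algebra on R^d, realised as 'I_d -> R:
   generated by the coordinate cylinders [set f | B (f i)], B Borel in R. *)
Definition rvec_borel (d : nat) : set (set ('I_d -> R)) :=
  <<s [set A | exists (i : 'I_d) (B : set R), measurable B /\ A = [set f | B (f i)]] >>.

Definition random_vector d {dT} (T : measurableType dT) (X : T -> 'I_d -> R) :=
  forall i, measurable_fun setT (fun t => X t i).

Definition same_law d {dT dT'} {T : measurableType dT} {T' : measurableType dT'}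
  (P : probability T R) (X : T -> 'I_d -> R)
  (P' : probability T' R) (Y : T' -> 'I_d -> R) :=
  forall A, rvec_borel A -> P (X @^-1` A) = P' (Y @^-1` A).

Definition independent_vectors d k {dT} {T : measurableType dT}
  (P : probability T R) (Y : 'I_k -> T -> 'I_d -> R) :=
  forall A : 'I_k -> set ('I_d -> R), (forall j, rvec_borel (A j)) ->
    P (\bigcap_(j in [set: 'I_k]) (Y j @^-1` A j)) =
    (\prod_(j < k) P (Y j @^-1` A j))%E.

Definition permanental d {dT} {T : measurableType dT} (P : probability T R)
  (psi : T -> 'I_d -> R) (G : 'M[R]_d) (beta : R) :=
  [/\ random_vector psi,
      (forall t i, 0 <= psi t i) &
      forall alpha : 'rV[R]_d, (forall i, 0 <= alpha ord0 i) ->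
        0 < \det (1%:M + diag_mx alpha *m G) /\
        (\int[P]_t (expR (- (2^-1 * \sum_(i < d) alpha ord0 i * psi t i)))%:E
          = ((\det (1%:M + diag_mx alpha *m G)) `^ (- beta))%:E)%E].

Definition infinitely_divisible d {dT} {T : measurableType dT}
  (P : probability T R) (psi : T -> 'I_d -> R) :=
  forall k : nat, (0 < k)%N ->
    exists (dT' : measure_display) (T' : measurableType dT')
           (P' : probability T' R) (Y : 'I_k -> T' -> 'I_d -> R),
      [/\ forall j, random_vector (Y j),
          independent_vectors P' Y,
          forall j j', same_law P' (Y j) P' (Y j') &
          same_law P' (fun t i => \sum_(j < k) Y j t i) P psi].

Definition effectively_equivalent m (A B : 'M[R]_m) :=
  forall x : 'rV[R]_m,
    \det (1%:M + diag_mx x *m A) = \det (1%:M + diag_mx x *m B).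

Definition symmetrizable m (A : 'M[R]_m) :=
  exists B : 'M[R]_m, B^T = B /\ effectively_equivalent A B.

(* principal submatrix G_{I x I} (indices of I in increasing order) *)
Definition principal_submx d (G : 'M[R]_d) (I : {set 'I_d}) : 'M[R]_#|I| :=
  \matrix_(i < #|I|, j < #|I|) G (enum_val i) (enum_val j).

End Defs.

(* Main.v *)
Require Import Defs.
From HB Require Import structures.
From mathcomp Require Import all_boot all_order all_algebra.
From mathcomp Require Import all_classical all_reals all_analysis.
From mathcomp Require Import measurable_realfun.
From mathcomp Require Import ring lra.
Set Implicit Arguments. Unset Strict Implicit. Unset Printing Implicit Defensive.
Import Order.TTheory GRing.Theory Num.Theory.
Import numFieldNormedType.Exports.
Local Open Scope ring_scope.

(** Write [X = psi / 2] and [L(t) = E exp(t . X)], which equals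
    [det(1 - diag t G)^(-beta)] for [t <= 0].  Since the determinant is affine in
    each coordinate, [L] is the Laplace transform of a gamma law along each axis;
    hence the region [L < oo] is closed downwards, the formula holds on it with a
    positive determinant, and it can be left along an axis only where the
    determinant vanishes.

    For a triple of indices of a tilted kernel [A] with the two oriented cycle
    products [p <> q], this forces [p, q >= 0], not both zero.  A triple with
    [p = q] is symmetrizable, and [p <> q] survives all but finitely many tilts
    [A = G (1 + l G)^-1]; if at most one triple is symmetrizable the signs of the
    triples fit together into a signature making [A] entrywise nonnegative.
    Letting [l] grow, the adjugate of [G + 1/l] has nonpositive off-diagonal entries
    up to signature; a Dirichlet form argument then shows [det G <> 0], as otherwise
    two rows and the same two columns of [A] would be proportional.  So [G^-1] is,
    up to signature, a matrix [M] with nonpositive off-diagonal entries.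

    For such [M] and every [b > 0], [det(M + diag a)^(-b)] is a Laplace transform:
    after a large tilt it is a convergent combination with nonnegative coefficients
    of products of gamma transforms, and the tilt is undone by the extension
    principle above.  With [b = beta / k] this gives the [k]-th convolution root of
    the law of [psi], by uniqueness of multivariate Laplace transforms. *)

(** * Determinants and regions bounded by a determinant *)

Lemma det_mx33 (R : comNzRingType) (f : nat -> nat -> R) :
  \det (\matrix_(i < 3, j < 3) f i j) =
  f 0%N 0%N * (f 1%N 1%N * f 2%N 2%N - f 1%N 2%N * f 2%N 1%N)
  - f 0%N 1%N * (f 1%N 0%N * f 2%N 2%N - f 1%N 2%N * f 2%N 0%N)
  + f 0%N 2%N * (f 1%N 0%N * f 2%N 1%N - f 1%N 1%N * f 2%N 0%N).
Proof.
rewrite (expand_det_row _ ord0) !big_ord_recl big_ord0 /cofactor.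
rewrite !(expand_det_row _ ord0) !big_ord_recl !big_ord0 /cofactor !det_mx11 !mxE /=.
rewrite /bump /= !(addn0, add0n) !expr0 !expr1 sqrrN expr1n.
by rewrite -[(1 + 1)%N]/2%N; ring.
Qed.

(** Sylvester's identity: the block matrix with rows [(1, -U)] and [(V, 1)] becomes block triangular
    when multiplied, on the right or on the left, by the unipotent matrix with rows [(1, U)] and
    [(0, 1)]. *)
Lemma det_addmulmxC (R : comPzRingType) m n (U : 'M[R]_(m, n)) (V : 'M[R]_(n, m)) :
  \det (1%:M + U *m V) = \det (1%:M + V *m U).
Proof.
have e1 : block_mx 1%:M (- U) V 1%:M *m block_mx 1%:M U 0 1%:M =
  block_mx 1%:M 0 V (1%:M + V *m U).
  by rewrite mulmx_block !mulmx1 !mulmx0 !mul1mx !addr0 addrN addrC.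
have e2 : block_mx 1%:M U 0 1%:M *m block_mx 1%:M (- U) V 1%:M =
  block_mx (1%:M + U *m V) 0 V 1%:M.
  by rewrite mulmx_block !mul1mx !mul0mx !mulmx1 !add0r addNr.
have := congr1 determinant e1; have := congr1 determinant e2.
rewrite !det_mulmx mulrC !det_lblock !det_ublock !det1 !mulr1 !mul1r.
by move=> -> ->.
Qed.

(** * Determinantal polynomials in three variables *)

Section ThreeVariables.
Variables (R : realFieldType).

(** This is [det(1 - diag(x, y, z) A)] for a 3 by 3 matrix [A] with diagonal [a1, a2, a3], two-cycle
    products [cij = A i j * A j i], and [w] the sum of the two oriented three-cycle products. *)
Definition trivariate (a1 a2 a3 c12 c13 c23 w x y z : R) : R :=
  1 - a1 * x - a2 * y - a3 * z
  + (a1 * a2 - c12) * x * y + (a1 * a3 - c13) * x * z + (a2 * a3 - c23) * y * z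
  - (a1 * a2 * a3 - a1 * c23 - a2 * c13 - a3 * c12 + w) * x * y * z.

(** Models the set where a Laplace transform is finite. In the last three clauses positivity of [D]
    is asked only at the end of the move: for a [D] affine along each axis and positive at the
    start, this makes it positive on the whole segment. *)
Definition axis_region (D : R -> R -> R -> R) (F : R -> R -> R -> Prop) :=
  [/\ F 0 0 0,
      forall x y z x' y' z', F x y z -> x' <= x -> y' <= y -> z' <= z -> F x' y' z',
      forall x y z, F x y z -> 0 < D x y z &
   [/\ forall x y z u, F x y z -> 0 <= u -> 0 < D (x + u) y z -> F (x + u) y z,
       forall x y z u, F x y z -> 0 <= u -> 0 < D x (y + u) z -> F x (y + u) z &
       forall x y z u, F x y z -> 0 <= u -> 0 < D x y (z + u) -> F x y (z + u)]].

Lemma axis_region_swap12 a1 a2 a3 c12 c13 c23 w F :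
  axis_region (trivariate a1 a2 a3 c12 c13 c23 w) F ->
  axis_region (trivariate a2 a1 a3 c12 c23 c13 w) (fun x y z => F y x z).
Proof.
have E x y z : trivariate a2 a1 a3 c12 c23 c13 w x y z
    = trivariate a1 a2 a3 c12 c13 c23 w y x z by rewrite /trivariate; ring.
move=> [F0 Fd Fp [F1 F2 F3]]; split => //.
- by move=> x y z x' y' z' H ? ? ?; apply: Fd H _ _ _.
- by move=> x y z /Fp; rewrite E.
- by split => x y z u; rewrite E; [apply: F2|apply: F1|apply: F3].
Qed.

Lemma axis_region_swap23 a1 a2 a3 c12 c13 c23 w F :
  axis_region (trivariate a1 a2 a3 c12 c13 c23 w) F ->
  axis_region (trivariate a1 a3 a2 c13 c12 c23 w) (fun x y z => F x z y).
Proof.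
have E x y z : trivariate a1 a3 a2 c13 c12 c23 w x y z
    = trivariate a1 a2 a3 c12 c13 c23 w x z y by rewrite /trivariate; ring.
move=> [F0 Fd Fp [F1 F2 F3]]; split => //.
- by move=> x y z x' y' z' H ? ? ?; apply: Fd H _ _ _.
- by move=> x y z /Fp; rewrite E.
- by split => x y z u; rewrite E; [apply: F1|apply: F3|apply: F2].
Qed.

(** If [a1 < 0], the negative point [1 / a1] of the first axis lies in the region, and [1 - a1 x]
    vanishes there. *)
Lemma axis_region_diag_ge0 a1 a2 a3 c12 c13 c23 w F :
  axis_region (trivariate a1 a2 a3 c12 c13 c23 w) F -> 0 <= a1.
Proof.
move=> [F0 Fd Fp _]; rewrite leNgt; apply/negP => a0.
have : F a1^-1 0 0 by apply: Fd F0 _ _ _ => //; rewrite invr_le0 ltW.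
move=> /Fp; rewrite /trivariate !(mulr0, mul0r, addr0, subr0).
by rewrite divff ?lt_eqF// subrr ltxx.
Qed.

(** Suppose [c12 < 0] and climb to [y = 1 / (1 + a2)]. If [a1 = 0], lowering [x] reaches a zero. If
    [a1 > 0], the point [x = 1 / a1] is reachable because [c12 < 0], and lowering [y] to [0] from
    there gives [1 - a1 x = 0]. *)
Lemma axis_region_offdiag_ge0 a1 a2 a3 c12 c13 c23 w F :
  axis_region (trivariate a1 a2 a3 c12 c13 c23 w) F -> 0 <= c12.
Proof.
move=> H; have a1ge0 := axis_region_diag_ge0 H.
have a2ge0 := axis_region_diag_ge0 (axis_region_swap12 H).
case: H => F0 Fd Fp [F1 F2 F3]; rewrite leNgt; apply/negP => c0.
have nc : c12 != 0 by rewrite lt_eqF.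
have n2 : 1 + a2 != 0 by rewrite gt_eqF// ltr_wpDr.
have y0 : 0 < (1 + a2)^-1 by rewrite invr_gt0 ltr_wpDr.
have FY : F 0 (1 + a2)^-1 0.
  rewrite -[X in F _ X _]add0r; apply: F2 => //; first exact: ltW.
  rewrite (_ : trivariate _ _ _ _ _ _ _ _ _ _ = (1 + a2)^-1) //.
  by rewrite /trivariate; field; rewrite gt_eqF// ltr_wpDr.
move: a1ge0; rewrite le_eqVlt => /predU1P[a10|a1gt0].
  have : F ((1 + a2)^-1 / (c12 * (1 + a2)^-1)) (1 + a2)^-1 0.
    apply: Fd FY _ _ _ => //.
    by rewrite mulr_ge0_le0 ?invr_le0 ?nmulr_rle0 ?ltW// pmulr_llt0.
  move=> /Fp; rewrite (_ : trivariate _ _ _ _ _ _ _ _ _ _ = 0) ?ltxx//.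
  by rewrite /trivariate -a10; field; rewrite ?nc ?n2.
have : F a1^-1 (1 + a2)^-1 0.
  rewrite -[X in F X _ _]add0r; apply: F1 => //; first by rewrite invr_ge0 ltW.
  rewrite (_ : trivariate _ _ _ _ _ _ _ _ _ _ = - c12 * a1^-1 * (1 + a2)^-1).
    by rewrite !mulr_gt0 ?invr_gt0 ?oppr_gt0// ltr_wpDr.
  by rewrite /trivariate; field; rewrite ?n2 gt_eqF.
move=> /Fd /(_ (lexx a1^-1) (ltW y0) (lexx 0)) /Fp.
rewrite (_ : trivariate _ _ _ _ _ _ _ _ _ _ = 0) ?ltxx//.
by rewrite /trivariate; field; rewrite gt_eqF.
Qed.

(** On the line [y = -1], [z = 0] the polynomial is [1 + a2 + c12 x], with a zero at a negative [x]
    when [c12 > 0]. *)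
Lemma axis_region_diag0_offdiag a2 a3 c12 c13 c23 w F :
  axis_region (trivariate 0 a2 a3 c12 c13 c23 w) F -> c12 = 0.
Proof.
move=> H; have a2ge0 := axis_region_diag_ge0 (axis_region_swap12 H).
have := axis_region_offdiag_ge0 H; rewrite le_eqVlt => /predU1P[//|c0].
case: H => F0 Fd Fp _.
have : F (- ((1 + a2) / c12)) (-1) 0.
  by apply: Fd F0 _ _ _; rewrite // oppr_le0 // divr_ge0 ?addr_ge0 // ltW.
move=> /Fp; rewrite (_ : trivariate _ _ _ _ _ _ _ _ _ _ = 0) ?ltxx//.
by rewrite /trivariate; field; rewrite gt_eqF.
Qed.

(** Once [c12 = c13 = 0], the polynomial depends on [x] only through [- w x y z]. Since [x] may tend
    to minus infinity, [w y z >= 0] at reachable [(y, z)]; two points with opposite signs of [y z]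
    force [w = 0]. *)
Lemma axis_region_diag0_cycle a2 a3 c12 c13 c23 w F :
  axis_region (trivariate 0 a2 a3 c12 c13 c23 w) F -> w = 0.
Proof.
move=> H; have c12E := axis_region_diag0_offdiag H.
have c13E := axis_region_diag0_offdiag (axis_region_swap23 H).
have a2ge0 := axis_region_diag_ge0 (axis_region_swap12 H).
have a3ge0 := axis_region_diag_ge0 (axis_region_swap12 (axis_region_swap23 H)).
have key y z : F 0 y z -> 0 <= w * y * z.
  move=> Fyz; rewrite leNgt; apply/negP => wyz.
  case: H => F0 Fd Fp _.
  have D0 := Fp _ _ _ Fyz.
  have E x : trivariate 0 a2 a3 c12 c13 c23 w x y z =
       trivariate 0 a2 a3 c12 c13 c23 w 0 y z - (w * y * z) * x.
    by rewrite /trivariate c12E c13E; ring.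
  set K := trivariate _ _ _ _ _ _ _ _ _ _ in D0.
  have /Fp : F (K / (w * y * z)) y z.
    by apply: Fd Fyz _ _ _; rewrite // mulr_ge0_le0 ?invr_le0 ?ltW.
  by rewrite E -/K mulrCA divff ?mulr1 ?subrr ?ltxx// lt_eqF.
case: H => F0 Fd Fp [F1 F2 F3].
have F1m : F 0 (-1) (-1) by apply: Fd F0 _ _ _; rewrite ?lerN10.
have z0 : 0 < (1 + a3)^-1 by rewrite invr_gt0 ltr_wpDr.
have FZ : F 0 0 (1 + a3)^-1.
  rewrite -[X in F _ _ X]add0r; apply: F3 => //; first exact: ltW.
  rewrite (_ : trivariate _ _ _ _ _ _ _ _ _ _ = (1 + a3)^-1) //.
  by rewrite /trivariate; field; rewrite gt_eqF// ltr_wpDr.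
have F2m : F 0 (-1) (1 + a3)^-1 by apply: Fd FZ _ _ _; rewrite ?lerN10.
have := key _ _ F1m; have := key _ _ F2m.
rewrite !mulrN1 opprK mulNr oppr_ge0 pmulr_lle0// => w1 w2.
by apply/eqP; rewrite eq_le w1.
Qed.

(* In the coordinates [y_i = 1 / s_i - a_i] the polynomial is, up to a positive
   factor, [y1 y2 y3 - c23 y1 - c13 y2 - c12 y3 - w].  If [w] is very negative
   the region contains a point with [y2 y3 = c23], where lowering the first
   variable to [0] makes the polynomial vanish. *)
Lemma axis_region_cycle_gt0 a1 a2 a3 c12 c13 c23 w F :
  axis_region (trivariate a1 a2 a3 c12 c13 c23 w) F ->
  4 * c12 * c13 * c23 < w ^+ 2 -> 0 < w.
Proof.
move=> H cw; have a1ge0 := axis_region_diag_ge0 H.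
have H12 := axis_region_swap12 H; have H23 := axis_region_swap23 H.
have a2ge0 := axis_region_diag_ge0 H12.
have a3ge0 := axis_region_diag_ge0 (axis_region_swap12 H23).
have c12ge0 := axis_region_offdiag_ge0 H.
have c13ge0 := axis_region_offdiag_ge0 H23.
have c23ge0 := axis_region_offdiag_ge0 (axis_region_swap23 H12).
rewrite ltNge le_eqVlt; apply/negP => /predU1P[w0|w0].
  by move: cw; rewrite w0 expr0n/= ltNge !mulr_ge0.
have a2gt0 : 0 < a2.
  rewrite lt_def a2ge0 andbT; apply/eqP => a20; move: H12; rewrite a20.
  by move=> /axis_region_diag0_cycle w0'; rewrite w0' ltxx in w0.
(* Times [y3], the expression is the quadratic [c12 y3^2 + w y3 + c13 c23], of positive discriminant
   by [cw]. For [c12 > 0] the witness is its vertex; for [c12 = 0] it is any point beyond the root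
   of a linear function. *)
have [y3 y3gt0 y3w] : exists2 y3, 0 < y3 & c13 * (c23 / y3) + c12 * y3 + w < 0.
  move: c12ge0; rewrite le_eqVlt => /predU1P[c0|c12gt0].
    exists ((c13 * c23 + 1) / - w).
      by rewrite divr_gt0 ?oppr_gt0 ?ltr_wpDl ?mulr_ge0.
    have K0 : 0 < c13 * c23 + 1 by rewrite ltr_wpDl ?mulr_ge0.
    rewrite -c0 mul0r addr0.
    rewrite (_ : _ + w = w / (c13 * c23 + 1)); first by rewrite pmulr_llt0 ?invr_gt0.
    have nK : c13 * c23 + 1 != 0 by rewrite gt_eqF.
    by field; rewrite ?nK lt_eqF.
  exists (- w / (2 * c12)); first by rewrite divr_gt0 ?oppr_gt0 ?mulr_gt0.
  rewrite (_ : _ + w = (w ^+ 2 - 4 * c12 * c13 * c23) / (2 * w)).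
    by rewrite pmulr_rlt0 ?subr_gt0// invr_lt0 pmulr_rlt0.
  have nc : c12 != 0 by rewrite gt_eqF.
  by field; rewrite ?nc lt_eqF.
have y2ge0 : 0 <= c23 / y3 by rewrite divr_ge0 // ltW.
(* The value [y1 = c13 / y3 + 1] gives [y1 y3 - c13 = y3 > 0], which keeps the polynomial positive
   at the second stop of the climb. *)
have y1gt0 : 0 < c13 / y3 + 1 by rewrite ltr_wpDl // divr_ge0 // ltW.
pose d1 := a1 + (c13 / y3 + 1); pose d2 := a2 + c23 / y3; pose d3 := a3 + y3.
have d1gt0 : 0 < d1 by rewrite ltr_wpDl.
have d2gt0 : 0 < d2 by rewrite ltr_wpDr.
have d3gt0 : 0 < d3 by rewrite ltr_wpDl.
have Ea1 : a1 = d1 - (c13 / y3 + 1) by rewrite addrK.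
have Ea2 : a2 = d2 - c23 / y3 by rewrite addrK.
have Ea3 : a3 = d3 - y3 by rewrite addrK.
have nz : [/\ d1 != 0, d2 != 0, d3 != 0 & y3 != 0] by rewrite !gt_eqF.
case: nz => n1 n2 n3 ny.
case: H => F0 Fd Fp [F1 F2 F3].
(* The climb raises the third, then the first, then the second variable, with a positive polynomial
   at each stop. *)
have G1 : F 0 0 d3^-1.
  rewrite -[X in F _ _ X]add0r; apply: F3 => //; first by rewrite invr_ge0 ltW.
  rewrite (_ : trivariate _ _ _ _ _ _ _ _ _ _ = y3 / d3) ?divr_gt0//.
  by rewrite /trivariate Ea3; field.
have G2 : F d1^-1 0 d3^-1.
  rewrite -[X in F X _ _]add0r; apply: F1 => //; first by rewrite invr_ge0 ltW.
  rewrite (_ : trivariate _ _ _ _ _ _ _ _ _ _ = y3 / (d1 * d3)).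
    by rewrite divr_gt0 ?mulr_gt0.
  by rewrite /trivariate Ea3 Ea1; field; rewrite ?n1 ?n3 ?ny.
have G3 : F d1^-1 d2^-1 d3^-1.
  rewrite -[X in F _ X _]add0r; apply: F2 => //; first by rewrite invr_ge0 ltW.
  rewrite (_ : trivariate _ _ _ _ _ _ _ _ _ _ =
    - (c13 * (c23 / y3) + c12 * y3 + w) / (d1 * d2 * d3)).
    by rewrite divr_gt0 ?oppr_gt0 ?mulr_gt0.
  by rewrite /trivariate Ea3 Ea1 Ea2; field; rewrite ?n1 ?n2 ?n3 ?ny.
have /Fp : F 0 d2^-1 d3^-1 by apply: Fd G3 _ _ _; rewrite // invr_ge0 ltW.
rewrite (_ : trivariate _ _ _ _ _ _ _ _ _ _ = 0) ?ltxx//.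
by rewrite /trivariate Ea3 Ea2; field; rewrite ?n2 ?n3 ?ny.
Qed.

End ThreeVariables.

Definition cycle3 (R : pzRingType) d (A : 'M[R]_d) i j k := A i j * A j k * A k i.

Section Admissible.
Variables (R : realFieldType) (d : nat).
Implicit Types (A G : 'M[R]_d) (F : 'rV[R]_d -> Prop) (s t : 'rV[R]_d).

Definition axis (i : 'I_d) : 'rV[R]_d := delta_mx 0 i.

(** The perturbation factors through a space of dimension three, so [det_addmulmxC] reduces it to a
    3 by 3 determinant. The indices may coincide, which [admissible_offdiag_ge0] uses. *)
Lemma det_perturb3 A (i j k : 'I_d) (x y z : R) :
  \det (1%:M - diag_mx (x *: axis i + y *: axis j + z *: axis k) *m A) =
  trivariate (A i i) (A j j) (A k k) (A i j * A j i) (A i k * A k i)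
    (A j k * A k j) (cycle3 A i j k + cycle3 A i k j) x y z.
Proof.
pose f (m : nat) := nth i [:: i; j; k] m.
pose s (m : nat) := nth 0 [:: x; y; z] m.
pose U := \matrix_(a < d, m < 3) (- (s m *+ (a == f m))).
pose V := \matrix_(m < 3, b < d) A (f m) b.
have -> : 1%:M - diag_mx (x *: axis i + y *: axis j + z *: axis k) *m A =
          1%:M + U *m V.
  congr (_ + _); apply/matrixP => a b; rewrite mul_diag_mx !mxE.
  rewrite !big_ord_recl big_ord0 !mxE /f /s /= addr0 !mulNr.
  by case: (a =P i) => [<-|_]; case: (a =P j) => [<-|_]; case: (a =P k) => [<-|_] /=; ring.
rewrite det_addmulmxC.
pose g (m n : nat) := (m == n)%:R - A (f m) (f n) * s n.
have -> : 1%:M + V *m U = \matrix_(m < 3, n < 3) g m n.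
  apply/matrixP => m n; rewrite !mxE; congr (_ + _).
  rewrite (bigD1 (f n)) //= big1 => [|a /negPf an].
    by rewrite !mxE eqxx addr0 mulrN.
  by rewrite !mxE an mulr0n oppr0 mulr0.
by rewrite (det_mx33 g) /g /= /f /s /= /trivariate /cycle3; ring.
Qed.

(** The analogue of [axis_region] in [d] variables; [F s] stands for finiteness of the Laplace
    transform at [s]. *)
Definition admissible A F :=
  [/\ F 0,
      forall s t, F s -> (forall i, t 0 i <= s 0 i) -> F t,
      forall s, F s -> 0 < \det (1%:M - diag_mx s *m A) &
      forall s i u, F s -> 0 <= u ->
        0 < \det (1%:M - diag_mx (s + u *: axis i) *m A) -> F (s + u *: axis i)].

Lemma admissible_region A F i j k : admissible A F ->
  axis_region (trivariate (A i i) (A j j) (A k k) (A i j * A j i) (A i k * A k i)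
    (A j k * A k j) (cycle3 A i j k + cycle3 A i k j))
    (fun x y z => F (x *: axis i + y *: axis j + z *: axis k)).
Proof.
move=> [F0 Fd Fp Fe]; split.
- by rewrite !scale0r !addr0.
- move=> x y z x' y' z' Fx xx yy zz; apply: Fd Fx _ => l; rewrite !mxE.
  by rewrite !lerD // ler_wpM2r // ler0n.
- by move=> x y z /Fp; rewrite det_perturb3.
- split=> x y z u Fx u0; rewrite -det_perturb3 scalerDl.
  + by rewrite !(addrAC _ (u *: _)); apply: Fe.
  + by rewrite addrA !(addrAC _ (u *: _)); apply: Fe.
  + by rewrite addrA; apply: Fe.
Qed.

Lemma admissible_offdiag_ge0 A F i j : admissible A F -> 0 <= A i j * A j i.
Proof. by move=> /(admissible_region i j i)/axis_region_offdiag_ge0. Qed.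

(** Let [p] and [q] be the two oriented products. Then [p q = c12 c13 c23 >= 0], and the condition
    [4 c12 c13 c23 < w^2] with [w = p + q] reads [(p - q)^2 > 0]. So [p + q > 0], and neither can be
    negative. *)
Lemma admissible_cycle_ge0 A F i j k : admissible A F ->
  cycle3 A i j k != cycle3 A i k j -> 0 <= cycle3 A i j k.
Proof.
move=> AF pq; have := admissible_region i j k AF.
move=> /axis_region_cycle_gt0 H.
have pq0 : 0 <= cycle3 A i j k * cycle3 A i k j.
  rewrite (_ : _ * _ = (A i j * A j i) * (A i k * A k i) * (A j k * A k j)).
    by apply: mulr_ge0; [apply: mulr_ge0|]; exact: admissible_offdiag_ge0 AF.
  by rewrite /cycle3; ring.
have : 0 < cycle3 A i j k + cycle3 A i k j.
  apply: H; rewrite -subr_gt0.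
  rewrite (_ : _ - _ = (cycle3 A i j k - cycle3 A i k j) ^+ 2).
    by rewrite lt_def sqr_ge0 andbT expf_eq0 /= subr_eq0.
  by rewrite /cycle3; ring.
by move: pq0; set p := cycle3 _ _ _ _; set q := cycle3 _ _ _ _ => pq0 pq1; nra.
Qed.

(** A zero diagonal entry would force both [p + q = 0] and [p q = 0], hence [p = q]. *)
Lemma admissible_diag_gt0 A F i j k : admissible A F ->
  cycle3 A i j k != cycle3 A i k j -> 0 < A i i.
Proof.
move=> AF pq; have H := admissible_region i j k AF.
rewrite lt_def (axis_region_diag_ge0 H) andbT; apply: contraNneq pq => ai0.
rewrite ai0 in H; have w0 := axis_region_diag0_cycle H.
have c0 := axis_region_diag0_offdiag H.
have pq0 : cycle3 A i j k * cycle3 A i k j = 0.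
  rewrite (_ : _ * _ = (A i j * A j i) * (A i k * A k i) * (A j k * A k j)).
    by rewrite c0 !mul0r.
  by rewrite /cycle3; ring.
move: pq0 w0; set p := cycle3 _ _ _ _; set q := cycle3 _ _ _ _.
by move=> /eqP; rewrite mulf_eq0 => /orP[] /eqP ->; rewrite ?add0r ?addr0 => ->.
Qed.

Lemma det_tilt A s t : 1%:M - diag_mx s *m A \in unitmx ->
  \det (1%:M - diag_mx (s + t) *m A) =
  \det (1%:M - diag_mx t *m (A *m invmx (1%:M - diag_mx s *m A))) *
  \det (1%:M - diag_mx s *m A).
Proof.
move=> us; rewrite -det_mulmx mulmxBl mul1mx mulmxA mulmxKV//.
by rewrite -addrA -opprD -mulmxDl -linearD.
Qed.

(** Translating the region by [s] amounts to exponential tilting: the determinant factors as that of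
    the tilted kernel times a positive constant. *)
Lemma admissible_tilt A F s : admissible A F -> F s ->
  admissible (A *m invmx (1%:M - diag_mx s *m A)) (fun t => F (s + t)).
Proof.
move=> [F0 Fd Fp Fe] Fs; have D0 := Fp _ Fs.
have us : 1%:M - diag_mx s *m A \in unitmx by rewrite unitmxE unitfE gt_eqF.
split; first by rewrite addr0.
- by move=> t t' Ft tt'; apply: Fd Ft _ => i; rewrite !mxE lerD2l.
- by move=> t /Fp; rewrite det_tilt// pmulr_lgt0.
- move=> t i u Ft u0 Dt; rewrite addrA; apply: Fe => //.
  by rewrite -addrA det_tilt// pmulr_lgt0.
Qed.

End Admissible.

(** * Signature of a tilted kernel *)

Section Signature.
Variables (R : realFieldType) (d : nat).
Implicit Types (A : 'M[R]_d) (F : 'rV[R]_d -> Prop).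

(** A 3 by 3 determinant sees only the sum of the two oriented cycle products; their equality is
    what allows a symmetric representative. *)
Definition balanced A i j k := cycle3 A i j k == cycle3 A i k j.

Definition at_most_one_balanced A := forall i j k i' j' k',
  uniq [:: i; j; k] -> uniq [:: i'; j'; k'] ->
  balanced A i j k -> balanced A i' j' k' -> [set i; j; k]%SET = [set i'; j'; k']%SET.

Lemma exists_fresh (s : seq 'I_d) : (size s < d)%N -> exists l, l \notin s.
Proof.
move=> sd; apply/existsP; apply: contraLR sd; rewrite negb_exists -leqNgt.
move=> /forallP sP; rewrite -[X in (X <= _)%N]card_ord cardE; apply: uniq_leq_size.
  exact: enum_uniq.
by move=> x _; have := sP x; rewrite negbK.
Qed.

(** As [d > 3], the pair extends to two different triples, and they cannot both be balanced. *)
Lemma unbalanced_third A i j : (3 < d)%N -> at_most_one_balanced A -> i != j ->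
  exists2 k, uniq [:: i; j; k] & ~~ balanced A i j k.
Proof.
move=> d3 A1 ij.
have [k kP] : exists k, k \notin [:: i; j] by apply: exists_fresh; apply: ltn_trans d3.
have [l lP] : exists l, l \notin [:: i; j; k] by exact: exists_fresh.
move: kP lP; rewrite !inE !negb_or => /andP[ki kj] /and3P[li lj lk].
have uk : uniq [:: i; j; k] by rewrite /= !inE negb_or ij eq_sym ki eq_sym kj.
have ul : uniq [:: i; j; l] by rewrite /= !inE negb_or ij eq_sym li eq_sym lj.
case bk : (balanced A i j k); last by exists k; rewrite ?bk.
case bl : (balanced A i j l); last by exists l; rewrite ?bl.
have /setP/(_ l) := A1 _ _ _ _ _ _ uk ul bk bl.
by rewrite !inE eqxx orbT (negPf li) (negPf lj) (negPf lk).
Qed.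

Let sg_sum_id (a b : R) : 0 <= a * b -> a != 0 -> Num.sg (a + b) = Num.sg a.
Proof.
move=> ab; rewrite neq_lt => /orP[a0|a0].
  by rewrite !ltr0_sg //; nra.
by rewrite !gtr0_sg //; nra.
Qed.

Let sg_sum_ge0 (a b : R) : 0 <= a * b -> 0 <= Num.sg (a + b) * a.
Proof.
have [->|a0 ab] := eqVneq a 0; first by rewrite mulr0.
by rewrite sg_sum_id // -normrEsg.
Qed.

(** The edge signs [sigma] have product [1] around every triangle. An unbalanced triangle has this
    by nonnegativity of its cycle products, the possible balanced one by the other faces of a
    tetrahedron. Such a sign pattern is a coboundary, given by the signs towards a base index
    [i0]. *)
Lemma signature_exists A F : (3 < d)%N -> admissible A F ->
  at_most_one_balanced A ->
  (exists s : {ffun 'I_d -> bool}, forall i j, i != j ->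
     0 <= (-1) ^+ s i * A i j * (-1) ^+ s j) /\ (forall i, 0 < A i i).
Proof.
move=> d3 AF A1.
have [i0 _] : exists i0, i0 \notin ([::] : seq 'I_d).
  by apply: exists_fresh; apply: ltn_trans d3.
split; last first.
  move=> i; have [j] : exists j, j \notin [:: i] by apply: exists_fresh; apply: ltn_trans d3.
  rewrite inE eq_sym => ij; have [k _ b] := unbalanced_third d3 A1 ij.
  exact: admissible_diag_gt0 AF b.
(* [A i j] and [A j i] never have opposite signs, so their sum records the common sign even if one
   of them vanishes. *)
pose sigma i j := Num.sg (A i j + A j i).
have sigmaC i j : sigma i j = sigma j i by rewrite /sigma addrC.
have c0 i j : 0 <= A i j * A j i by exact: admissible_offdiag_ge0 AF.
have unb i j k : ~~ balanced A i j k -> sigma i j * sigma j k * sigma k i = 1.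
  move=> b; have p0 := admissible_cycle_ge0 AF b.
  have q0 : 0 <= cycle3 A i k j.
    by apply: (admissible_cycle_ge0 AF); rewrite eq_sym.
  have : (0 < cycle3 A i j k) || (0 < cycle3 A i k j).
    rewrite !lt_def p0 q0 !andbT -negb_and; apply: contra b => /andP[/eqP p /eqP q].
    by rewrite /balanced p q.
  case/orP => H.
    have := gt_eqF H; rewrite /cycle3 !mulf_eq0 => /negbT.
    rewrite !negb_or => /andP[/andP[n1 n2] n3].
    by rewrite /sigma !sg_sum_id // -!sgrM gtr0_sg.
  have := gt_eqF H; rewrite /cycle3 !mulf_eq0 => /negbT.
  rewrite !negb_or => /andP[/andP[n1 n2] n3].
  rewrite (sigmaC i j) (sigmaC j k) (sigmaC k i) /sigma !sg_sum_id // -!sgrM.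
  by rewrite gtr0_sg//; move: H; rewrite /cycle3; congr (0 < _); ring.
have sq i j : i != j -> sigma i j * sigma i j = 1.
  move=> ij; have [k _ b] := unbalanced_third d3 A1 ij.
  rewrite -sgrM gtr0_sg// -expr2 lt_def sqr_ge0 andbT expf_eq0 /=.
  rewrite -sgr_eq0 -/(sigma i j); apply: contraTneq isT => s0.
  by have := unb _ _ _ b; rewrite s0 !mul0r => /esym/eqP; rewrite oner_eq0.
have all3 i j k : uniq [:: i; j; k] -> sigma i j * sigma j k * sigma k i = 1.
  move=> u; have [b|] := boolP (balanced A i j k); last exact: unb.
  (* The three faces through [l] are unbalanced. In the product of their signs each edge at [l]
     occurs twice and cancels. *)
  have [l lP] : exists l, l \notin [:: i; j; k] by exact: exists_fresh.
  move: (lP) (u); rewrite /= !inE !negb_or andbT.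
  move=> /and3P[li lj lk] /andP[/andP[ij ik] jk].
  have nb x y : x != y -> x \in [:: i; j; k] -> y \in [:: i; j; k] ->
      ~~ balanced A x y l.
    move=> xy xs ys; apply/negP => b'.
    have u' : uniq [:: x; y; l].
      rewrite /= !inE negb_or xy /= andbT.
      by apply/andP; split; apply: contraNneq lP => <-.
    have /setP/(_ l) := A1 _ _ _ _ _ _ u u' b b'.
    by rewrite !inE eqxx orbT (negPf li) (negPf lj) (negPf lk).
  have e1 := unb _ _ _ (nb i j ij _ _); have e2 := unb _ _ _ (nb j k jk _ _).
  have e3 := unb _ _ _ (nb i k ik _ _).
  rewrite !inE !eqxx ?orbT in e1 e2 e3.
  have {}e1 := e1 isT isT; have {}e2 := e2 isT isT; have {}e3 := e3 isT isT.
  have s1 := sq _ _ li; have s2 := sq _ _ lj; have s3 := sq _ _ lk.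
  rewrite (sigmaC j l) in e1; rewrite (sigmaC k l) in e2 e3.
  rewrite (sigmaC k i).
  transitivity ((sigma i j * sigma l j * sigma l i) * (sigma j k * sigma l k * sigma l j)
    * (sigma i k * sigma l k * sigma l i)); last by rewrite e1 e2 e3 !mulr1.
  rewrite -[LHS]mulr1 -s1 -[LHS]mulr1 -s2 -[LHS]mulr1 -s3.
  clear; move: (sigma i j) (sigma j k) (sigma i k) (sigma l i) (sigma l j) (sigma l k).
  by move=> *; ring.
pose s := [ffun i => (i != i0) && (sigma i i0 < 0)].
have sE i : i != i0 -> (-1) ^+ s i = sigma i i0.
  move=> ii; rewrite ffunE ii /=; have := sq _ _ ii.
  rewrite /sigma sgr_lt0; case: (ltrgtP (A i i0 + A i0 i) 0) => [H|H|->].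
  - by rewrite ltr0_sg.
  - by rewrite gtr0_sg.
  - by rewrite sgr0 mul0r => /esym/eqP; rewrite oner_eq0.
exists s => i j ij.
suff sij : (-1) ^+ s i * (-1) ^+ s j = sigma i j.
  by rewrite mulrAC sij; apply: sg_sum_ge0.
have s0 : (-1) ^+ s i0 = 1 :> R by rewrite ffunE eqxx.
have [ii|ii] := eqVneq i i0; first by rewrite ii s0 mul1r sE 1?sigmaC// -ii eq_sym.
have [jj|jj] := eqVneq j i0; first by rewrite jj s0 mulr1 sE.
rewrite !sE//; have u : uniq [:: i; j; i0] by rewrite /= !inE negb_or ij ii jj.
have := all3 _ _ _ u; rewrite (sigmaC i0 i) => e.
rewrite -[LHS]mul1r -(sq _ _ ij).
rewrite -[RHS]mulr1 -e; clear.
by move: (sigma i j) (sigma j i0) (sigma i i0) => *; ring.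
Qed.

End Signature.

(** * Dirichlet forms and annihilators of a nonnegative matrix *)

Section Energy.
Variables (R : realFieldType) (d : nat).
Implicit Types (A N : 'M[R]_d).

(* With [x = A 1], [y = 1 A] and [h_i = A i j / x_i], the weights [y_i N_ik x_k]
   have zero row and column sums, and [N A = 0] makes the Dirichlet form
   [\sum_(i, k) y_i N_ik x_k (h_i - h_k)^2] vanish. *)
Lemma annihilator_rows_prop A N a b :
  (forall i j, i != j -> 0 <= A i j) -> (forall i, 0 < A i i) ->
  (forall i j, i != j -> N i j <= 0) -> A *m N = 0 -> N *m A = 0 ->
  a != b -> N a b != 0 -> exists r, forall j, A b j = r * A a j.
Proof.
move=> Aoff Adiag Noff AN NA ab Nab.
have A0 i j : 0 <= A i j.
  by have [->|] := eqVneq i j; [exact: ltW|exact: Aoff].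
pose x i := \sum_j A i j; pose y j := \sum_i A i j.
have x0 i : 0 < x i.
  by rewrite /x (bigD1 i)//= ltr_wpDr// sumr_ge0.
have y0 i : 0 < y i.
  by rewrite /y (bigD1 i)//= ltr_wpDr// sumr_ge0.
have Nx i : \sum_k N i k * x k = 0.
  under eq_bigr => k _ do rewrite /x mulr_sumr.
  rewrite exchange_big big1//= => j _.
  by have /matrixP/(_ i j) := NA; rewrite !mxE.
have yN k : \sum_i y i * N i k = 0.
  under eq_bigr => i _ do rewrite /y mulr_suml.
  rewrite exchange_big big1//= => j _.
  by have /matrixP/(_ j k) := AN; rewrite !mxE.
have hE j : A b j / x b = A a j / x a.
  pose h i := A i j / x i.
  have Nh i : \sum_k N i k * x k * h k = 0.
    have /matrixP/(_ i j) := NA; rewrite !mxE => {2}<-.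
    apply: eq_bigr => k _; rewrite /h -mulrA; congr (_ * _).
    by rewrite mulrCA divff ?mulr1// gt_eqF.
  (* Expanding the square, the terms in [h i ^+ 2] vanish by [Nx], those in [h k ^+ 2] by [yN], and
     the cross terms by [Nh]. *)
  have E : \sum_i \sum_k - (y i * N i k * x k * (h i - h k) ^+ 2) = 0.
    have E1 : \sum_i \sum_k y i * N i k * x k * h i ^+ 2 = 0.
      rewrite big1// => i _; transitivity (y i * h i ^+ 2 * \sum_k N i k * x k).
        by rewrite mulr_sumr; apply: eq_bigr => k _; ring.
      by rewrite Nx mulr0.
    have E2 : \sum_i \sum_k y i * N i k * x k * h k ^+ 2 = 0.
      rewrite exchange_big big1// => k _.
      transitivity ((\sum_i y i * N i k) * (x k * h k ^+ 2)).
        by rewrite mulr_suml; apply: eq_bigr => i _; ring.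
      by rewrite yN mul0r.
    have E3 : \sum_i \sum_k y i * h i * (N i k * x k * h k) = 0.
      by rewrite big1// => i _; rewrite -mulr_sumr Nh mulr0.
    transitivity (\sum_i \sum_k (2 * (y i * h i * (N i k * x k * h k))
        - y i * N i k * x k * h i ^+ 2 - y i * N i k * x k * h k ^+ 2)).
      by apply: eq_bigr => i _; apply: eq_bigr => k _; ring.
    under eq_bigr => i _ do rewrite !big_split/= !sumrN -mulr_sumr.
    by rewrite !big_split /= !sumrN -mulr_sumr E1 E2 E3 mulr0 !subr0.
  have T0 i k : 0 <= - (y i * N i k * x k * (h i - h k) ^+ 2).
    have [->|ik] := eqVneq i k; first by rewrite subrr expr0n mulr0 oppr0.
    rewrite oppr_ge0 mulr_le0_ge0 ?sqr_ge0// mulr_le0_ge0 ?(ltW (x0 _))//.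
    by rewrite mulr_ge0_le0 ?Noff// ltW.
  have /eqP := E; rewrite psumr_eq0; last by move=> i _; apply: sumr_ge0.
  move=> /allP/(_ a); rewrite mem_index_enum => /(_ isT) /=.
  rewrite psumr_eq0// => /allP/(_ b); rewrite mem_index_enum => /(_ isT) /=.
  rewrite oppr_eq0 !mulf_eq0 (negPf Nab) (gt_eqF (y0 a)) (gt_eqF (x0 b)) /= orbb subr_eq0.
  by move=> /eqP; rewrite /h => ->.
exists (x b / x a) => j; have := hE j.
move=> /(congr1 (fun z => z * x b)); rewrite divfK ?gt_eqF// => ->.
by rewrite mulrC mulrA mulrAC.
Qed.

(** If [N] has a nonzero off-diagonal entry, the previous lemma gives rows directly and columns by
    transposition. Otherwise [N] is diagonal, and [N A = 0] with a positive diagonal of [A] gives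
    [N = 0]. *)
Lemma annihilator_prop A N :
  (forall i j, i != j -> 0 <= A i j) -> (forall i, 0 < A i i) ->
  (forall i j, i != j -> N i j <= 0) -> A *m N = 0 -> N *m A = 0 ->
  N != 0 -> exists a b, [/\ a != b, exists r, forall j, A b j = r * A a j &
    exists r, forall j, A j b = r * A j a].
Proof.
move=> Aoff Adiag Noff AN NA N0.
have [[[a b] /= /andP[ab Nab]]|H] :=
    pselect (exists t : 'I_d * 'I_d, (t.1 != t.2) && (N t.1 t.2 != 0)).
  exists a, b; split => //; first exact: (annihilator_rows_prop Aoff _ Noff AN NA).
  have [r rP] : exists r, forall j, A^T a j = r * A^T b j.
    apply: (@annihilator_rows_prop A^T N^T b a).
    - by move=> i j ij; rewrite mxE Aoff// eq_sym.
    - by move=> i; rewrite mxE.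
    - by move=> i j ij; rewrite mxE Noff// eq_sym.
    - by rewrite -trmx_mul NA trmx0.
    - by rewrite -trmx_mul AN trmx0.
    - by rewrite eq_sym.
    - by rewrite mxE.
  have r0 : r != 0.
    by have := rP a; rewrite mxE; apply: contra_eqN => /eqP ->; rewrite mul0r gt_eqF.
  exists r^-1 => j; have := rP j; rewrite !mxE => ->.
  by rewrite mulKf.
have Ndiag i j : i != j -> N i j = 0.
  by move=> ij; apply/eqP; apply: contrapT => /negP nij; apply: H; exists (i, j); rewrite /= ij.
exfalso; move/negP: N0; apply; apply/eqP/matrixP => i j; rewrite mxE.
have [<-|/Ndiag//] := eqVneq i j.
have /matrixP/(_ i i) := NA; rewrite !mxE (bigD1 i)//= big1 => [|k ki].
  by rewrite addr0 => /eqP; rewrite mulf_eq0 (gt_eqF (Adiag i)) orbF => /eqP.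
by rewrite Ndiag ?mul0r// eq_sym.
Qed.
End Energy.

(** * Signs and roots of polynomials *)

Section PolynomialLimits.
Variable R : realFieldType.

Lemma poly_nonroot_ge (p : {poly R}) (x : R) : p != 0 ->
  exists2 y, x <= y & p.[y] != 0.
Proof.
move=> p0; apply: contrapT => H.
pose rs := [seq x + n%:R | n <- iota 0 (size p)].
have := @max_poly_roots _ p rs p0; rewrite size_map size_iota ltnn.
have -> : all (root p) rs.
  apply/allP => _ /mapP[n _ ->]; apply: contrapT => /negP nr; apply: H.
  by exists (x + n%:R); rewrite ?lerDl.
have -> : uniq rs.
  rewrite map_inj_uniq ?iota_uniq// => m n /addrI/eqP.
  by rewrite eqr_nat => /eqP.
by move=> /(_ isT isT).
Qed.

(** To the right of [0] the polynomial behaves like its lowest term. Here [p = (p_r + t X) X^r],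
    with [t] bounded by [K] on the unit interval. *)
Lemma poly_low_coef_le0 (p : {poly R}) (r : nat) :
  (forall m, (m < r)%N -> p`_m = 0) ->
  (forall e, 0 < e -> exists2 u, 0 < u < e & p.[u] <= 0) -> p`_r <= 0.
Proof.
move=> pr H; rewrite leNgt; apply/negP => c0.
pose t := drop_poly r.+1 p.
have pE : p = ((p`_r)%:P + t * 'X) * 'X^r.
  apply/polyP => n; rewrite mulrDl coefD coefCM coefXn -mulrA -exprS coefMXn.
  rewrite coef_drop_poly.
  case: (ltngtP n r) => [nr|rn|->].
  - by rewrite pr// mulr0 add0r ltnS ltnW.
  - by rewrite mulr0 add0r ltnNge rn /= subnK.
  - by rewrite mulr1 ltnSn addr0.
pose K := \sum_(i < size t) `|t`_i| + 1.
have K0 : 0 < K by rewrite ltr_wpDl// sumr_ge0.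
have e0 : 0 < Num.min 1 (p`_r / K) by rewrite lt_min ltr01 divr_gt0.
have [u /andP[u0 uK]] := H _ e0.
rewrite pE hornerM hornerXn leNgt => /negP; apply.
move: uK; rewrite lt_min => /andP[u1 uK].
rewrite mulr_gt0 ?exprn_gt0// hornerD hornerC hornerM hornerX.
have tu : `|t.[u]| <= K.
  rewrite horner_coef (le_trans (ler_norm_sum _ _ _))// /K ler_wpDr//.
  apply: ler_sum => i _; rewrite normrM ler_piMr// normrX exprn_ile1//.
  by rewrite gtr0_norm// ltW.
move: uK; rewrite ltr_pdivlMr// => uK.
have : `|t.[u] * u| <= K * u by rewrite normrM (gtr0_norm u0) ler_pM2r.
by rewrite ler_norml => /andP[+ _]; lra.
Qed.
End PolynomialLimits.

(** * Constant tilts of the kernel *)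

Section Resolvent.
Variables (R : realFieldType) (d : nat).
Implicit Types (G A : 'M[R]_d) (F : 'rV[R]_d -> Prop).

(** The kernel tilted by the constant vector [-l]. *)
Definition resolvent G (l : R) := G *m invmx (1%:M + l *: G).

Lemma balancedZ (c : R) A i j k : c != 0 -> balanced (c *: A) i j k = balanced A i j k.
Proof.
move=> c0; have c30 : c ^+ 3 != 0 by rewrite expf_neq0.
have E x y z : cycle3 (c *: A) x y z = c ^+ 3 * cycle3 A x y z.
  by rewrite /cycle3 !mxE; ring.
by rewrite /balanced !E (inj_eq (mulfI c30)).
Qed.

Lemma balanced_sign (s : 'I_d -> bool) A i j k :
  balanced (\matrix_(x, y) ((-1) ^+ s x * A x y * (-1) ^+ s y)) i j k =
  balanced A i j k.
Proof.
have ss x : (-1) ^+ s x * (-1) ^+ s x = 1 :> R by rewrite -expr2 sqrr_sign.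
have E x y z : cycle3 (\matrix_(x, y) ((-1) ^+ s x * A x y * (-1) ^+ s y)) x y z
   = cycle3 A x y z.
  transitivity ((-1) ^+ s x * (-1) ^+ s x * ((-1) ^+ s y * (-1) ^+ s y) *
    ((-1) ^+ s z * (-1) ^+ s z) * cycle3 A x y z); last by rewrite !ss !mul1r.
  rewrite /cycle3 !mxE; move: ((-1) ^+ s x) ((-1) ^+ s y) ((-1) ^+ s z) => *.
  by ring.
by rewrite /balanced !E.
Qed.

Lemma admissible_resolvent G F l : admissible G F -> 0 <= l ->
  0 < \det (1%:M + l *: G) /\
  exists F', admissible (resolvent G l) F'.
Proof.
move=> GF l0.
have Fl : F (const_mx (- l)).
  by case: GF => F0 Fd _ _; apply: Fd F0 _ => i; rewrite !mxE oppr_le0.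
have E : 1%:M + l *: G = 1%:M - diag_mx (const_mx (- l)) *m G.
  by rewrite diag_const_mx mul_scalar_mx scaleNr opprK.
split; first by rewrite E; case: GF => _ _ /(_ _ Fl).
by exists (fun t => F (const_mx (- l) + t)); rewrite /resolvent E; apply: admissible_tilt.
Qed.

(** Up to a nonzero factor, the difference of the two cycle products of the tilted kernel is a
    polynomial in [l] whose value at [0] is that of [G]. The product of these over the unbalanced
    triples of [G] is a nonzero polynomial, so it has arbitrarily large nonroots. *)
Lemma resolvent_frequently G F l0 : admissible G F -> at_most_one_balanced G ->
  exists l, [/\ l0 <= l, 0 < l & at_most_one_balanced (resolvent G l)].
Proof.
move=> GF G1.
pose P : 'M[{poly R}]_d := map_mx polyC G.
pose B : 'M[{poly R}]_d := P *m \adj (1%:M + 'X *: P).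
have BE l : map_mx (horner_eval l) B = G *m \adj (1%:M + l *: G).
  have EP : map_mx (horner_eval l) P = G.
    by apply/matrixP => i j; rewrite !mxE /horner_eval hornerC.
  rewrite map_mxM map_mx_adj EP; congr (_ *m \adj _).
  by rewrite map_mxD map_mx1 map_mxZ EP /= /horner_eval hornerX.
pose Phi (t : 'I_d * 'I_d * 'I_d) :=
  cycle3 B t.1.1 t.1.2 t.2 - cycle3 B t.1.1 t.2 t.1.2.
have PhiE l t : (Phi t).[l] =
   cycle3 (G *m \adj (1%:M + l *: G)) t.1.1 t.1.2 t.2 -
   cycle3 (G *m \adj (1%:M + l *: G)) t.1.1 t.2 t.1.2.
  rewrite -BE /Phi /cycle3 !hornerE.
  by congr (_ * _ * _ - _ * _ * _); rewrite [RHS]mxE.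
pose p := \prod_(t | ~~ balanced G t.1.1 t.1.2 t.2) Phi t.
have p0 : p != 0.
  apply/negP => /eqP /(congr1 (horner^~ 0)); rewrite horner0 horner_prod => /eqP.
  apply/negP; rewrite prodf_seq_neq0; apply/allP => t _; apply/implyP => nb.
  by rewrite PhiE scale0r addr0 adj1 mulmx1 subr_eq0.
have [l ll pl] := poly_nonroot_ge (Num.max l0 1) p0.
move: ll; rewrite ge_max => /andP[ll l1].
have lgt0 : 0 < l by apply: lt_le_trans l1.
exists l; split => //.
have [D0 _] := admissible_resolvent GF (ltW lgt0).
have RE : resolvent G l = (\det (1%:M + l *: G))^-1 *: (G *m \adj (1%:M + l *: G)).
  by rewrite /resolvent /invmx unitmxE unitfE gt_eqF// scalemxAr.
have nb i j k : balanced (resolvent G l) i j k -> balanced G i j k.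
  apply: contraTT => b; rewrite RE balancedZ ?invr_eq0 ?gt_eqF//.
  move: pl; rewrite /p horner_prod (bigD1 (i, j, k)) //= mulf_eq0 negb_or.
  by move=> /andP[+ _]; rewrite PhiE /= subr_eq0.
by move=> i j k i' j' k' u u' /nb b /nb b'; apply: G1.
Qed.

Definition signature_nonneg (s : {ffun 'I_d -> bool}) A :=
  (forall i j, i != j -> 0 <= (-1) ^+ s i * A i j * (-1) ^+ s j) /\
  (forall i, 0 < A i i).

(** Pigeonhole: there are finitely many signatures, so if each failed beyond some threshold, a good
    [l] beyond all thresholds would have none. *)
Lemma resolvent_signature G F : (3 < d)%N -> admissible G F -> at_most_one_balanced G ->
  exists s, forall l0, exists l, [/\ l0 <= l, 0 < l,
    at_most_one_balanced (resolvent G l) & signature_nonneg s (resolvent G l)].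
Proof.
move=> d3 GF G1; apply: contrapT => /forallNP H.
have {}H (s : {ffun 'I_d -> bool}) : exists l0, forall l, l0 <= l -> 0 < l ->
    at_most_one_balanced (resolvent G l) -> ~ signature_nonneg s (resolvent G l).
  apply: contrapT => /forallNP K; apply: (H s) => l0; apply: contrapT => /forallNP K'.
  by apply: (K l0) => l l1 l2 l3 l4; apply: (K' l).
have [f fP] := choice H.
have [l [ll l0 l1]] := resolvent_frequently (\sum_s `|f s|) GF G1.
have [_ [F' F'P]] := admissible_resolvent GF (ltW l0).
have [[s sP] dP] := signature_exists d3 F'P l1.
apply: (fP s l) => //; apply: le_trans ll.
by rewrite (bigD1 s)//= (le_trans (ler_norm _))// lerDl sumr_ge0.
Qed.

Lemma det_scale_shift G l : 0 < l ->
  \det (1%:M + l *: G) = l ^+ d * \det (l^-1%:M + G).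
Proof.
move=> l0; rewrite -detZ scalerDr scale_scalar_mx divff ?gt_eqF//.
Qed.

(** From [l R = 1 - (1 + l G)^-1] with [R] the resolvent: off the diagonal, the adjugate of
    [1 / l + G] is a negative multiple of [R]. *)
Lemma resolvent_offdiag G F l i j : admissible G F -> 0 < l -> i != j ->
  0 < \det (l^-1%:M + G) /\
  \adj (l^-1%:M + G) i j = - (l ^+ 2 * \det (l^-1%:M + G)) * resolvent G l i j.
Proof.
move=> GF l0 ij; have [D0 _] := admissible_resolvent GF (ltW l0).
have ln0 : l != 0 by rewrite gt_eqF.
have ld0 : 0 < l ^+ d by rewrite exprn_gt0.
have D1 : 0 < \det (l^-1%:M + G).
  by move: D0; rewrite det_scale_shift// pmulr_rgt0.
split => //.
have u0 : 1%:M + l *: G \in unitmx by rewrite unitmxE unitfE gt_eqF.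
have E : l *: resolvent G l = 1%:M - invmx (1%:M + l *: G).
  rewrite /resolvent scalemxAl -{1}(addKr 1%:M (l *: G)) mulmxDl mulmxV// mulNmx mul1mx.
  by rewrite addrC.
have E2 : invmx (1%:M + l *: G) = (l * \det (l^-1%:M + G))^-1 *: \adj (l^-1%:M + G).
  apply: (can_inj (mulKmx u0)); rewrite mulmxV// -scalemxAr.
  have -> : 1%:M + l *: G = l *: (l^-1%:M + G).
    by rewrite scalerDr scale_scalar_mx divff.
  rewrite -scalemxAl mul_mx_adj !scale_scalar_mx mulrA invfM.
  by congr (_%:M); field; rewrite ln0 gt_eqF.
have /matrixP/(_ i j) := E; rewrite E2; clear -ij l0 D1 ln0.
move: (resolvent G l) (\adj _) (\det _) D1 => A Q D D0.
rewrite !mxE (negPf ij) sub0r => e.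
have -> : Q i j = - (l * D) * (- ((l * D)^-1 * Q i j)).
  by field; rewrite ln0 gt_eqF.
by rewrite -e; ring.
Qed.

End Resolvent.

(** * Invertibility of the kernel and signs of its inverse *)

Section InverseZMatrix.
Variables (R : realFieldType) (d : nat).
Implicit Types (G A : 'M[R]_d) (F : 'rV[R]_d -> Prop).

Let adjp G : 'M[{poly R}]_d := \adj ('X%:M + map_mx polyC G).

Let adjpE G u : map_mx (horner_eval u) (adjp G) = \adj (u%:M + G).
Proof.
rewrite map_mx_adj map_mxD map_scalar_mx /= /horner_eval hornerX.
by congr (\adj (_ + _)); apply/matrixP => i j; rewrite !mxE /horner_eval hornerC.
Qed.

(** [N] is the lowest nonzero coefficient matrix, at order [r], of [adj(X + G)]; the value at
    [X = 0] may itself vanish. Comparing terms of order [r] in [(X + G) adj(X + G) = D] gives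
    [G N = N G = D_r], and [det G = 0] forces [D_r = 0]. *)
Let adjp_low_coef G : \det G = 0 -> exists N r,
  [/\ N != 0, G *m N = 0, N *m G = 0,
      forall i j, N i j = (adjp G i j)`_r &
      forall i j m, (m < r)%N -> (adjp G i j)`_m = 0].
Proof.
move=> detG; pose P := map_mx polyC G; pose D : {poly R} := \det ('X%:M + P).
have D0 : D != 0.
  have -> : D = char_poly (- G).
    by rewrite /char_poly /char_poly_mx /D map_mxN opprK.
  exact: monic_neq0 (char_poly_monic _).
have d0 : (0 < d)%N.
  by move: (d) G detG {P D D0} => [|//] G; rewrite det_mx00 => /eqP; rewrite oner_eq0.
have e1 : ('X%:M + P) *m adjp G = D%:M by rewrite mul_mx_adj.
have e2 : adjp G *m ('X%:M + P) = D%:M by rewrite mul_adj_mx.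
have ex : exists m, [exists i, exists j, (adjp G i j)`_m != 0].
  have : exists i j, adjp G i j != 0.
    apply: contrapT => /forallNP H; move/negP: D0; apply.
    have a0 : adjp G = 0.
      apply/matrixP => i j; rewrite [RHS]mxE; apply/eqP; apply: contrapT => /negP n.
      by apply: (H i); exists j.
    by have /matrixP/(_ (Ordinal d0) (Ordinal d0)) := e1; rewrite a0 mulmx0 !mxE eqxx mulr1n => <-.
  move=> [i [j n0]]; exists (size (adjp G i j)).-1.
  apply/existsP; exists i; apply/existsP; exists j.
  by rewrite -[_ (polyseq _) _]/(lead_coef _) lead_coef_eq0.
pose r := ex_minn ex.
have [rP rmin] : [exists i, exists j, (adjp G i j)`_r != 0] /\
    forall m, [exists i, exists j, (adjp G i j)`_m != 0] -> (r <= m)%N.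
  by rewrite /r; case: ex_minnP.
have low i j m : (m < r)%N -> (adjp G i j)`_m = 0.
  move=> mr; apply/eqP; apply: contraLR mr => n0; rewrite -leqNgt; apply: rmin.
  by apply/existsP; exists i; apply/existsP; exists j.
move: (adjp G) low rP e1 e2 => Q low /existsP[i0 /existsP[j0 n0]] e1 e2.
pose N := \matrix_(i, j) (Q i j)`_r.
have lowX i j : ('X * Q i j)`_r = 0.
  by rewrite coefXM; case: eqP => // /eqP r0; rewrite low// prednK// lt0n.
have GN : G *m N = (D`_r)%:M.
  apply/matrixP => i j; have /matrixP/(_ i j) := e1.
  rewrite mulmxDl mul_scalar_mx !mxE => /(congr1 (fun p : {poly R} => p`_r)).
  rewrite coefD lowX add0r coef_sum coefMn => <-.
  by apply: eq_bigr => k _; rewrite !mxE coefCM.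
have NG : N *m G = (D`_r)%:M.
  apply/matrixP => i j; have /matrixP/(_ i j) := e2.
  rewrite mulmxDr mul_mx_scalar !mxE => /(congr1 (fun p : {poly R} => p`_r)).
  rewrite coefD lowX add0r coef_sum coefMn => <-.
  by apply: eq_bigr => k _; rewrite !mxE coefMC.
have Dr : D`_r = 0.
  have /eqP := congr1 determinant GN; rewrite det_mulmx detG mul0r det_scalar.
  by rewrite eq_sym expf_eq0 => /andP[_ /eqP].
exists N, r; split => //; last by move=> i j; rewrite mxE.
- by apply: contraNneq n0 => /matrixP/(_ i0 j0); rewrite !mxE => /eqP.
- by rewrite GN Dr raddf0.
- by rewrite NG Dr raddf0.
Qed.

Lemma admissible_inverse_Zmatrix G F : (3 < d)%N -> admissible G F ->
  at_most_one_balanced G ->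
  0 < \det G /\ exists s : {ffun 'I_d -> bool}, forall i j, i != j ->
     (-1) ^+ s i * invmx G i j * (-1) ^+ s j <= 0.
Proof.
move=> d3 GF G1; have [s sP] := resolvent_signature d3 GF G1.
have small i j (p := adjp G i j * ((-1) ^+ s i * (-1) ^+ s j)%:P) : i != j ->
    forall e, 0 < e -> exists2 u, 0 < u < e & p.[u] <= 0.
  move=> ij e e0; have [l [el l0 _ [/(_ _ _ ij) off _]]] := sP (e^-1 + 1).
  exists l^-1.
    rewrite invr_gt0 l0 /= invf_plt ?posrE//; apply: lt_le_trans el.
    by rewrite ltrDl.
  rewrite /p hornerM hornerC.
  have -> : (adjp G i j).[l^-1] = \adj (l^-1%:M + G) i j.
    by rewrite -adjpE [RHS]mxE.
  have [D0 ->] := resolvent_offdiag GF l0 ij.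
  rewrite !mulNr oppr_le0 -mulrA mulr_ge0//.
    by rewrite mulr_ge0 ?exprn_ge0 ?ltW.
  by rewrite mulrA (mulrC (resolvent _ _ _ _)).
have low i j r : i != j -> (forall m, (m < r)%N -> (adjp G i j)`_m = 0) ->
    (-1) ^+ s i * (adjp G i j)`_r * (-1) ^+ s j <= 0.
  move=> ij z; rewrite mulrAC mulrC -coefMC; apply: poly_low_coef_le0.
    by move=> m mr; rewrite coefMC z// mul0r.
  exact: small.
have detG0 : \det G != 0.
  apply/eqP => /adjp_low_coef[N [r [N0 GN NG NE Nlow]]].
  have [l [_ l0 l1 [off dia]]] := sP 0.
  have [D0 _] := admissible_resolvent GF (ltW l0).
  have u0 : 1%:M + l *: G \in unitmx by rewrite unitmxE unitfE gt_eqF.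
  pose C (M : 'M[R]_d) := \matrix_(x, y) ((-1) ^+ s x * M x y * (-1) ^+ s y).
  have ss x : (-1) ^+ s x * (-1) ^+ s x = 1 :> R by rewrite -expr2 sqrr_sign.
  have CM M M' : C M *m C M' = C (M *m M').
    apply/matrixP => x y; rewrite !mxE mulr_sumr mulr_suml; apply: eq_bigr => k _.
    rewrite !mxE; transitivity ((-1) ^+ s x * (M x k * M' k y) * (-1) ^+ s y *
      ((-1) ^+ s k * (-1) ^+ s k)); last by rewrite ss mulr1.
    by move: ((-1) ^+ s x) ((-1) ^+ s y) ((-1) ^+ s k) => *; ring.
  have C0 : C 0 = 0 by apply/matrixP => x y; rewrite !mxE mulr0 mul0r.
  have RN : resolvent G l *m N = 0.
    rewrite /resolvent.
    have -> : G *m invmx (1%:M + l *: G) = invmx (1%:M + l *: G) *m G.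
      apply: (can_inj (mulKmx u0)); rewrite mulKVmx// mulmxA.
      have -> : (1%:M + l *: G) *m G = G *m (1%:M + l *: G).
        by rewrite mulmxDl mulmxDr mul1mx mulmx1 -scalemxAl -scalemxAr.
      by rewrite mulmxK.
    by rewrite -mulmxA GN mulmx0.
  have NR : N *m resolvent G l = 0 by rewrite /resolvent mulmxA NG mul0mx.
  have [a [b [ab [r1 rP1] [r2 rP2]]]] : exists a b, [/\ a != b,
      exists r, forall j, C (resolvent G l) b j = r * C (resolvent G l) a j &
      exists r, forall j, C (resolvent G l) j b = r * C (resolvent G l) j a].
    apply: (@annihilator_prop _ _ (C (resolvent G l)) (C N)).
    - by move=> i j ij; rewrite mxE off.
    - by move=> i; rewrite mxE mulrAC ss mul1r.
    - by move=> i j ij; rewrite mxE NE low//; exact: Nlow.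
    - by rewrite CM RN.
    - by rewrite CM NR.
    - apply: contraNneq N0 => CN; apply/eqP/matrixP => x y.
      have /matrixP/(_ x y) := CN; rewrite !mxE => /eqP.
      by rewrite !mulf_eq0 !signr_eq0 orbF => /eqP.
  (* Proportional rows and columns [a], [b] equate the two cycle products of every triple [a, b, k],
     contradicting the choice of [k]. *)
  have [k _] := unbalanced_third d3 l1 ab.
  rewrite -(balanced_sign s) -/(C _) /balanced /cycle3 => /negP; apply; apply/eqP.
  rewrite (rP2 a) (rP1 k) (rP2 k) (rP1 a).
  by move: (C _) => M; ring.
have detG : 0 < \det G.
  rewrite lt_def detG0 /=.
  pose p : {poly R} := \det ('X%:M + map_mx polyC G).
  have pE u : p.[u] = \det (u%:M + G).
    rewrite -[LHS]/(horner_eval u p) /p -det_map_mx map_mxD map_scalar_mx /=.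
    rewrite /horner_eval hornerX; congr (\det (_ + _)).
    by apply/matrixP => i j; rewrite !mxE /horner_eval hornerC.
  (* [det G] is the limit of the positive numbers [det(1 / l + G)], hence nonnegative; this is read
     off the constant coefficient of [- p]. *)
  have -> : \det G = - (- p)`_0.
    by rewrite coefN opprK -horner_coef0 pE raddf0 add0r.
  rewrite oppr_ge0; apply: poly_low_coef_le0 => // e e0.
  have [l [el l0 _ _]] := sP (e^-1 + 1); exists l^-1.
    rewrite invr_gt0 l0 /= invf_plt ?posrE//; apply: lt_le_trans el.
    by rewrite ltrDl.
  rewrite hornerN pE oppr_le0; have [D0 _] := admissible_resolvent GF (ltW l0).
  by move: D0; rewrite det_scale_shift// pmulr_rgt0 ?exprn_gt0// => /ltW.
split => //; exists s => i j ij.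
have -> : invmx G i j = (\det G)^-1 * (adjp G i j)`_0.
  rewrite -horner_coef0.
  have -> : (adjp G i j).[0] = \adj (0%:M + G) i j by rewrite -adjpE [RHS]mxE.
  by rewrite raddf0 add0r /invmx unitmxE unitfE detG0 mxE.
rewrite mulrCA -mulrA pmulr_rle0 ?invr_gt0// low//.
Qed.

End InverseZMatrix.

(** * Symmetrizable triples *)

Section Symmetrizable.
Variable R : realType.

Lemma det_diag3 (A : 'M[R]_3) (x : 'rV[R]_3) (i := ord0) (j := lift ord0 ord0)
    (k := lift ord0 (lift ord0 ord0)) :
  \det (1%:M + diag_mx x *m A) =
  trivariate (A i i) (A j j) (A k k) (A i j * A j i) (A i k * A k i)
    (A j k * A k j) (cycle3 A i j k + cycle3 A i k j)
    (- x ord0 i) (- x ord0 j) (- x ord0 k).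
Proof.
rewrite -det_perturb3; congr (\det (_ + _)); rewrite -mulNmx -raddfN.
congr (diag_mx _ *m _); apply/matrixP => a b; rewrite !ord1 !mxE eqxx /=.
have /or3P[] : [|| b == i, b == j | b == k] by case: b => -[|[|[|]]].
- by move=> /eqP ->; rewrite eqxx /=; ring.
- by move=> /eqP ->; rewrite eqxx /=; ring.
- by move=> /eqP ->; rewrite eqxx /=; ring.
Qed.

(** The symmetric matrix has off-diagonal entries [sqrt(A i j * A j i)], with the sign of the cycle
    product placed on one edge. The size is a variable equal to [3] because principal submatrices
    have size [#|I|]. *)
Lemma symmetrizable_of_balanced n (A : 'M[R]_n) : n = 3%N ->
  (forall i j, 0 <= A i j * A j i) -> (forall i j k, balanced A i j k) ->
  symmetrizable A.
Proof.
move=> n3; subst n => c0 bal.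
pose i : 'I_3 := ord0; pose j : 'I_3 := lift ord0 ord0.
pose k : 'I_3 := lift ord0 (lift ord0 ord0).
pose p := cycle3 A i j k.
pose e : R := if 0 <= p then 1 else -1.
have ee : e * e = 1 by rewrite /e; case: ifP; rewrite ?mulr1// mulrNN mulr1.
pose b x y := Num.sqrt (A x y * A y x).
have bb x y : b x y * b x y = A x y * A y x by rewrite -expr2 sqr_sqrtr.
have bp : b i j * b i k * (e * b j k) = p.
  have P2 : p ^+ 2 = A i j * A j i * (A i k * A k i) * (A j k * A k j).
    rewrite expr2 {2}/p (eqP (bal i j k)) /p /cycle3; ring.
  transitivity (e * (b i j * b i k * b j k)); first by ring.
  have c2 : 0 <= A i j * A j i * (A i k * A k i) by apply: mulr_ge0.
  rewrite /b -(sqrtrM _ (c0 i j)) -(sqrtrM _ c2) -P2 sqrtr_sqr /e.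
  case: ifP => p0; first by rewrite ger0_norm// mul1r.
  by rewrite ltr0_norm ?mulN1r ?opprK// ltNge p0.
pose B : 'M[R]_3 := \matrix_(x, y) if x == y then A x x else
  if (x + y == 1)%N then b i j else if (x + y == 2)%N then b i k else e * b j k.
exists B; split.
  by apply/matrixP => x y; rewrite !mxE eq_sym addnC; case: eqP => [->|].
move=> x; rewrite !det_diag3 -/i -/j -/k.
have [Bii Bjj Bkk] : [/\ B i i = A i i, B j j = A j j & B k k = A k k].
  by rewrite !mxE !eqxx.
have [Bij Bji] : B i j = b i j /\ B j i = b i j by rewrite !mxE.
have [Bik Bki] : B i k = b i k /\ B k i = b i k by rewrite !mxE.
have [Bjk Bkj] : B j k = e * b j k /\ B k j = e * b j k by rewrite !mxE.
rewrite Bii Bjj Bkk Bij Bji Bik Bki Bjk Bkj !bb mulrACA ee mul1r bb.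
congr (trivariate _ _ _ _ _ _ _ _ _ _).
rewrite -(eqP (bal i j k)) -/p /cycle3 Bij Bjk Bki Bik Bkj Bji.
by rewrite -[in LHS]bp; ring.
Qed.

Lemma symmetrizable_principal d (G : 'M[R]_d) i j k :
  (forall i j, 0 <= G i j * G j i) -> uniq [:: i; j; k] -> balanced G i j k ->
  symmetrizable (principal_submx G [set i; j; k]%SET).
Proof.
move=> c0 u bal; apply: symmetrizable_of_balanced.
- move: u; rewrite /= !inE negb_or andbT => /andP[/andP[ij ik] jk].
  rewrite finset.setUC cardsU1 cards2 ij !inE negb_or [k == i]eq_sym ik.
  by rewrite [k == j]eq_sym jk.
- by move=> a b; rewrite !mxE.
move=> a b c; rewrite /balanced /cycle3 !mxE.
have := enum_valP a; have := enum_valP b; have := enum_valP c.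
move: (enum_val a) (enum_val b) (enum_val c) => x y z; rewrite !inE.
move/eqP: bal; rewrite /cycle3 => bal.
by move=> /orP[/orP[]|] /eqP -> /orP[/orP[]|] /eqP -> /orP[/orP[]|] /eqP ->;
  apply/eqP; lra.
Qed.

Lemma at_most_one_balanced_of_symmetrizable d (G : 'M[R]_d) F :
  admissible G F ->
  (forall I J : {set 'I_d}, #|I| = 3%N -> #|J| = 3%N ->
     symmetrizable (principal_submx G I) ->
     symmetrizable (principal_submx G J) -> I = J) ->
  at_most_one_balanced G.
Proof.
move=> GF H i j k i' j' k' u u' b b'.
have c0 i1 j1 : 0 <= G i1 j1 * G j1 i1 by exact: admissible_offdiag_ge0 GF.
have card3 x y z : uniq [:: x; y; z] -> #|[set x; y; z]%SET : {set 'I_d}| = 3%N.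
  rewrite /= !inE negb_or andbT => /andP[/andP[ij ik] jk].
  by rewrite finset.setUC cardsU1 cards2 ij !inE negb_or [z == x]eq_sym ik [z == y]eq_sym jk.
by apply: H; rewrite ?card3//; apply: symmetrizable_principal.
Qed.

End Symmetrizable.

(** * Extension of Laplace transforms *)

Local Open Scope classical_set_scope.
Local Open Scope ring_scope.

(** * Dilations and the gamma integral *)

Section LebesgueScale.
Variable R : realType.
Notation mu := (@lebesgue_measure R).

Lemma lebesgue_measure_scale (a : R) (A : set R) : 0 < a -> measurable A ->
  mu A = (a%:E * mu ((fun x : R => (a * x)%R) @^-1` A))%E.
Proof.
move=> a0 mA.
have mf : measurable_fun setT ((fun x => a * x) : measurableTypeR R -> measurableTypeR R).
  exact: measurable_funM.
pose f : measurableTypeR R -> measurableTypeR R := fun x : R => a * x.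
pose an : {nonneg R} := NngNum (ltW a0).
have := @lebesgue_measure_unique R (mscale an (pushforward mu f)).
move=> /(_ mf _ A mA) ->//= _ [[x y]] _ <-.
pose I : set R := `]x / a, y / a]%classic.
rewrite [RHS](_ : _ = (a%:E * mu I)%E); last first.
  rewrite /mscale /pushforward /=; congr (_ * mu _)%E.
  by apply/seteqP; split => z /=;
    rewrite /I /f /= !in_itv /= ltr_pdivrMr// ler_pdivlMr// (mulrC z).
rewrite /I !lebesgue_measure_itv /= !lte_fin ltr_pM2r ?invr_gt0//.
case: ifPn => _; last by rewrite mule0.
by rewrite -EFinB -EFinM; congr EFin; field; rewrite gt_eqF.
Qed.

Lemma ge0_integral_scale (a : R) (f : R -> \bar R) : 0 < a ->
  measurable_fun setT f -> (forall x, 0 <= f x)%E ->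
  (\int[mu]_x f x = a%:E * \int[mu]_x f (a * x)%R)%E.
Proof.
move=> a0 mf f0.
have mg : measurable_fun setT ((fun x => a * x) : measurableTypeR R -> measurableTypeR R).
  exact: measurable_funM.
pose g : measurableTypeR R -> measurableTypeR R := fun x : R => a * x.
pose an : {nonneg R} := NngNum (ltW a0).
rewrite (@eq_measure_integral _ _ _ _ (mscale an (pushforward mu g))); last first.
  by move=> A mA _; exact: lebesgue_measure_scale.
rewrite ge0_integral_mscale//; congr (_ * _)%E.
by rewrite ge0_integral_pushforward.
Qed.

End LebesgueScale.

Section GammaIntegral.
Variable R : realType.
Notation mu := (@lebesgue_measure R).

(* Substituting [t = |u|^(1/b)] in Euler's integral for [2 b Gamma(b) x^(-b)]
   removes the singularity at [t = 0]. *)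
Definition gamma_int (b x : R) : \bar R :=
  (\int[mu]_u (expR (- (x * `|u| `^ b^-1)))%:E)%E.

Lemma measurable_abs_powR (c : R) : measurable_fun setT (fun u : R => `|u| `^ c).
Proof.
have h : measurable_fun [set: R] (@Num.norm _ R) by [].
exact: (@measurableT_comp _ _ _ _ _ _ (@powR R ^~ c) _ (@Num.norm _ R) (measurable_powR c) h).
Qed.

Lemma measurable_gamma_integrand b x :
  measurable_fun setT (fun u : R => expR (- (x * `|u| `^ b^-1))).
Proof.
apply: measurableT_comp => //; apply: measurableT_comp => //.
by apply: measurable_funM => //; exact: measurable_abs_powR.
Qed.

(** The dilation [u -> x^b u] turns [|u|^(1/b)] into [x |u|^(1/b)]. *)
Lemma gamma_int_scale b x : 0 < b -> 0 < x ->
  gamma_int b x = ((x `^ (- b))%:E * gamma_int b 1)%E.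
Proof.
move=> b0 x0; rewrite /gamma_int.
rewrite [X in (_ * X)%E](@ge0_integral_scale _ (x `^ b)); last 3 first.
- by rewrite powR_gt0.
- by apply/measurable_EFinP; exact: measurable_gamma_integrand.
- by move=> u; rewrite lee_fin expR_ge0.
rewrite muleA -EFinM powRN mulVf ?gt_eqF ?powR_gt0// mul1e.
apply: eq_integral => u _; congr (expR (- _))%:E.
rewrite mul1r normrM (ger0_norm (powR_ge0 _ _)) powRM ?powR_ge0//.
by rewrite -powRrM mulfV ?gt_eqF// powRr1// ltW.
Qed.

(** The integrand is at least [1] on the whole line. This is how a nonpositive determinant will show
    up as an infinite Laplace transform. *)
Lemma gamma_int_pinfty b x : x <= 0 -> gamma_int b x = +oo%E.
Proof.
move=> x0; apply/eqP; rewrite -leye_eq.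
have <- : (\int[mu]_(u in setT) (cst 1%:E) u = +oo)%E.
  rewrite integral_cst// mul1e.
  by have := @lebesgue_measure_itv R `]-oo, +oo[; rewrite set_itvE.
apply: ge0_le_integral => //.
- by apply/measurable_EFinP; exact: measurable_gamma_integrand.
- move=> u _; rewrite lee_fin -[leLHS]expR0 ler_expR oppr_ge0.
  by rewrite mulr_le0_ge0// powR_ge0.
Qed.

Lemma gamma_int_fin b : 0 < b -> (gamma_int b 1 < +oo)%E.
Proof.
move=> b0.
have c0 : 0 < b^-1 by rewrite invr_gt0.
(* With [t = |u|^(1/b)], the choice [N >= 2 b] gives [t^N >= u^2] for [|u| > 1]. As
   [e^t >= ((1 + t) / N)^N], the integrand is at most [K / (1 + u^2)]. *)
pose N := (Num.trunc (2 * b)).+1.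
have N1 : 1 <= N%:R :> R by rewrite ler1n.
have N0 : 0 < N%:R :> R by rewrite ltr0n.
have cN : 2 <= b^-1 * N%:R.
  by rewrite ler_pdivlMl// mulrC ltW// truncnS_gt.
pose K := 2 * N%:R ^+ N : R.
have K0 : 0 < K by rewrite mulr_gt0// exprn_gt0.
have bnd (u : R) : expR (- (1 * `|u| `^ b^-1)) <= K * (oneDsqr u)^-1.
  rewrite mul1r expRN -[K in leRHS]invrK -invfM lef_pV2 ?posrE ?expR_gt0//; last first.
    by rewrite mulr_gt0 ?invr_gt0// oneDsqr_gt0.
  set t := `|u| `^ b^-1; have t0 : 0 <= t by rewrite powR_ge0.
  have e1 : ((1 + t) / N%:R) ^+ N <= expR t.
    rewrite (_ : expR t = expR (t / N%:R) ^+ N); last first.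
      by rewrite -expRM_natl mulrC divfK// gt_eqF.
    apply: lerXn2r; rewrite ?nnegrE ?expR_ge0 ?divr_ge0 ?addr_ge0//.
    apply: le_trans (expR_ge1Dx _).
    by rewrite mulrDl lerD2r mul1r invf_le1.
  apply: le_trans e1; rewrite expr_div_n ler_pdivlMr ?exprn_gt0//.
  have -> : K^-1 * oneDsqr u * N%:R ^+ N = 2^-1 * oneDsqr u.
    by rewrite /K; field; rewrite gt_eqF ?exprn_gt0.
  rewrite ler_pdivrMl// mulr2n mulrDl mul1r /oneDsqr; apply: lerD.
    by apply: exprn_ege1; rewrite lerDl.
  have [u1|u1] := leP `|u| 1.
    apply: (@le_trans _ _ 1); last by apply: exprn_ege1; rewrite lerDl.
    by rewrite -real_normK ?num_real// expr_le1.
  apply: (@le_trans _ _ (t ^+ N)).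
    rewrite -real_normK ?num_real// -!powR_mulrn ?powR_ge0// /t -powRrM.
    by rewrite ler_powR// ltW.
  by apply: lerXn2r; rewrite ?nnegrE ?addr_ge0// lerDr.
apply: (@le_lt_trans _ _ (\int[mu]_u (K%:E * (oneDsqr u)^-1%:E))%E).
  apply: ge0_le_integral => //.
  - by apply/measurable_EFinP; exact: measurable_gamma_integrand.
  - apply: measurable_funeM; apply/measurable_EFinP.
    by apply: continuous_measurable_fun; exact: continuous_oneDsqrV.
  - by move=> u _; rewrite -EFinM lee_fin bnd.
rewrite ge0_integralZl//; last 2 first.
- apply/measurable_EFinP.
  by apply: continuous_measurable_fun; exact: continuous_oneDsqrV.
- by rewrite lee_fin ltW.
rewrite (@ge0_symfun_integralT _ (fun u : R => (oneDsqr u)^-1)).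
- by rewrite -set_itvcy integral0y_oneDsqr -!EFinM ltry.
- by move=> u; rewrite invr_ge0 ltW// oneDsqr_gt0.
- exact: continuous_oneDsqrV.
- by move=> u; rewrite /= /oneDsqr sqrrN.
Qed.

Lemma gamma_int_gt0 b : 0 < b -> (0 < gamma_int b 1)%E.
Proof.
move=> b0; apply: (@lt_le_trans _ _ (\int[mu]_(u in `[0%R, 1%R]) (expR (- 1))%:E)%E).
  rewrite integral_cst//= lebesgue_measure_itv /= lte_fin ltr01.
  by rewrite sube0 mule1 lte_fin expR_gt0.
apply: (@le_trans _ _ (\int[mu]_(u in `[0%R, 1%R]) (expR (- (1 * `|u| `^ b^-1)))%:E)%E).
  apply: ge0_le_integral => //.
  - apply/measurable_EFinP; apply: measurable_funTS.
    exact: measurable_gamma_integrand.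
  - move=> u; rewrite /= in_itv /= => /andP[u0 u1].
    rewrite lee_fin ler_expR lerN2 mul1r ger0_norm//.
    rewrite (_ : 1 = 1 `^ b^-1); last by rewrite powR1.
    by apply: ge0_ler_powR; rewrite ?nnegrE ?invr_ge0// ltW.
apply: ge0_subset_integral => //.
  by apply/measurable_EFinP; exact: measurable_gamma_integrand.
Qed.

Definition gamma_cst b : R := fine (gamma_int b 1).

Lemma gamma_cst_gt0 b : 0 < b -> 0 < gamma_cst b.
Proof. by move=> b0; rewrite fine_gt0// gamma_int_gt0// gamma_int_fin. Qed.

Lemma gamma_intE b x : 0 < b -> 0 < x ->
  gamma_int b x = (x `^ (- b) * gamma_cst b)%:E.
Proof.
move=> b0 x0; rewrite gamma_int_scale// EFinM fineK//.
by rewrite ge0_fin_numE ?gamma_int_fin// ltW// gamma_int_gt0.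
Qed.

End GammaIntegral.

Section ExponentialExtension.
Variables (R : realType) (dT dT' : measure_display).
Variables (T : measurableType dT) (T' : measurableType dT').
Variables (m : {measure set T -> \bar R}) (m' : {measure set T' -> \bar R}).

Let mterm dU (U : measurableType dU) (g X : U -> R) (u : R) (k j : nat) :
  measurable_fun setT g -> measurable_fun setT X ->
  measurable_fun setT (fun t =>
    (g t * (1 - expR (- (u * X t))) ^+ k * expR (- (u * X t)) ^+ j)%:E).
Proof.
move=> mg mX; apply/measurable_EFinP.
have mE : measurable_fun setT (fun t => expR (- (u * X t))).
  by apply: measurableT_comp => //; apply: measurableT_comp => //; exact: measurable_funM.
apply: measurable_funM; last exact: measurable_funX.
apply: measurable_funM => //; apply: measurable_funX; exact: measurable_funB.
Qed.

Let term_ge0 (u x y : R) (k j : nat) : 0 < u -> 0 <= x -> 0 <= y ->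
  0 <= y * (1 - expR (- (u * x))) ^+ k * expR (- (u * x)) ^+ j.
Proof.
move=> u0 x0 y0; rewrite mulr_ge0 ?exprn_ge0 ?expR_ge0// mulr_ge0 ?exprn_ge0//.
by rewrite subr_ge0 -expR0 ler_expR oppr_le0 mulr_ge0// ltW.
Qed.

Let step dU (U : measurableType dU) (n : {measure set U -> \bar R})
  (g X : U -> R) (u : R) (k j : nat) : 0 < u ->
  measurable_fun setT g -> measurable_fun setT X ->
  (forall t, 0 <= g t) -> (forall t, 0 <= X t) ->
  (\int[n]_t (g t * (1 - expR (- (u * X t))) ^+ k * expR (- (u * X t)) ^+ j)%:E =
   \int[n]_t (g t * (1 - expR (- (u * X t))) ^+ k.+1 * expR (- (u * X t)) ^+ j)%:E +
   \int[n]_t (g t * (1 - expR (- (u * X t))) ^+ k * expR (- (u * X t)) ^+ j.+1)%:E)%E.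
Proof.
move=> u0 mg mX g0 X0; rewrite -ge0_integralD//.
- by apply: eq_integral => t _; rewrite -EFinD; congr EFin; rewrite !exprS; ring.
- by move=> t _; rewrite lee_fin term_ge0.
- exact: mterm.
- by move=> t _; rewrite lee_fin term_ge0.
- exact: mterm.
Qed.

Let expand dU (U : measurableType dU) (n : {measure set U -> \bar R})
  (g X : U -> R) (u : R) : 0 < u ->
  measurable_fun setT g -> measurable_fun setT X ->
  (forall t, 0 <= g t) -> (forall t, 0 <= X t) ->
  (\int[n]_t (g t * expR (u * X t))%:E =
   \sum_(k <oo) \int[n]_t (g t * (1 - expR (- (u * X t))) ^+ k * expR (- (u * X t)) ^+ 0)%:E)%E.
Proof.
move=> u0 mg mX g0 X0; rewrite -integral_nneseries//; last 2 first.
- by move=> k; exact: mterm.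
- by move=> k t _; rewrite lee_fin term_ge0.
apply: eq_integral => t _; apply/esym/cvg_lim => //.
rewrite [X in X @ _](_ : _ =
    EFin \o series (geometric (g t) (1 - expR (- (u * X t))))); last first.
  apply/funext => k /=; rewrite -sumEFin; apply: eq_bigr => i _.
  by rewrite expr0 mulr1.
apply: cvg_EFin; first by apply: nearW.
have := @cvg_geometric_series R (g t) (1 - expR (- (u * X t))).
rewrite subKr expRN invrK; apply.
rewrite ger0_norm; last by rewrite subr_ge0 -expRN -expR0 ler_expR oppr_le0 mulr_ge0// ltW.
by rewrite ltrBlDr ltrDl invr_gt0 expR_gt0.
Qed.

(* [e^(u X) = \sum_n (1 - e^(- u X))^n], so integrals of [e^(u X)] are determined by
   those of [e^(- j u X)], even when they are infinite. *)
Lemma laplace_determines_exp (g X : T -> R) (g' X' : T' -> R) (u : R) : 0 < u ->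
  measurable_fun setT g -> measurable_fun setT X ->
  measurable_fun setT g' -> measurable_fun setT X' ->
  (forall t, 0 <= g t) -> (forall t, 0 <= X t) ->
  (forall t, 0 <= g' t) -> (forall t, 0 <= X' t) ->
  (\int[m]_t (g t)%:E < +oo)%E ->
  (forall j : nat, \int[m]_t (g t * expR (- (u * X t)) ^+ j)%:E =
                  \int[m']_t (g' t * expR (- (u * X' t)) ^+ j)%:E)%E ->
  (\int[m]_t (g t * expR (u * X t))%:E = \int[m']_t (g' t * expR (u * X' t))%:E)%E.
Proof.
move=> u0 mg mX mg' mX' g0 X0 g'0 X'0 goo E; rewrite !expand//.
have fin k j : (\int[m]_t (g t * (1 - expR (- (u * X t))) ^+ k *
    expR (- (u * X t)) ^+ j)%:E)%E \is a fin_num.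
  rewrite ge0_fin_numE; last by apply: integral_ge0 => t _; rewrite lee_fin term_ge0.
  apply: le_lt_trans goo; apply: ge0_le_integral => //.
  - by move=> t _; rewrite lee_fin term_ge0.
  - exact: mterm.
  - exact/measurable_EFinP.
  - move=> t _; rewrite lee_fin -mulrA ler_piMr// mulr_ile1 ?exprn_ge0 ?expR_ge0//.
    + by rewrite subr_ge0 -expR0 ler_expR oppr_le0 mulr_ge0// ltW.
    + apply: exprn_ile1; last by rewrite lerBlDr lerDl expR_ge0.
      by rewrite subr_ge0 -expR0 ler_expR oppr_le0 mulr_ge0// ltW.
    + apply: exprn_ile1; rewrite ?expR_ge0//.
      by rewrite -expR0 ler_expR oppr_le0 mulr_ge0// ltW.
suff EE k j : (\int[m]_t (g t * (1 - expR (- (u * X t))) ^+ k * expR (- (u * X t)) ^+ j)%:E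
  = \int[m']_t (g' t * (1 - expR (- (u * X' t))) ^+ k * expR (- (u * X' t)) ^+ j)%:E)%E.
  by apply: eq_eseriesr => k _; exact: EE.
elim: k j => [|k IH] j.
  by have := E j; congr (_ = _); apply: eq_integral => t _; rewrite expr0 mulr1.
(* The term to be cancelled is finite for [m], hence for [m'] by induction, so it may be
   subtracted. *)
have := IH j; rewrite (step _ _ _ u0 mg mX)// (step _ _ _ u0 mg' mX')//.
rewrite IH => e; have f1 := fin k j.+1; rewrite IH in f1.
by move/(congr1 (fun z => z - \int[m']_t (g' t * (1 - expR (- (u * X' t))) ^+ k *
  expR (- (u * X' t)) ^+ j.+1)%:E)%E): e; rewrite !addeK.
Qed.

End ExponentialExtension.

(** Only row [i] depends on [u], and it does so affinely. *)
Lemma det_diag_affine (R : realFieldType) d (M A : 'M[R]_d) (th : 'rV[R]_d) i u :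
  \det (M + diag_mx (th + u *: axis R i) *m A) =
  (1 - u) * \det (M + diag_mx th *m A) +
  u * \det (M + diag_mx (th + axis R i) *m A).
Proof.
apply: (@determinant_multilinear _ _ _ _ _ i).
- apply/rowP => j; rewrite !mul_diag_mx !mxE eqxx /=; ring.
- apply/matrixP => k j; rewrite !mul_diag_mx !mxE !eqxx /=.
  by rewrite eq_sym (negPf (neq_lift _ _)) mulr0 addr0.
- apply/matrixP => k j; rewrite !mul_diag_mx !mxE !eqxx /=.
  by rewrite eq_sym (negPf (neq_lift _ _)) mulr0 addr0.
Qed.

Section Extension.
Variables (R : realType) (d : nat) (dT : measure_display) (T : measurableType dT).
Variables (m : {measure set T -> \bar R}) (X : T -> 'I_d -> R).
Hypothesis mX : forall i, measurable_fun setT (fun t => X t i).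
Hypothesis X0 : forall t i, 0 <= X t i.
Variables (b : R) (M A : 'M[R]_d).
Hypothesis b0 : 0 < b.

Definition laplace (th : 'rV[R]_d) : \bar R :=
  (\int[m]_t (expR (\sum_i th 0 i * X t i))%:E)%E.

Let D (th : 'rV[R]_d) : R := \det (M + diag_mx th *m A).
Let good th := 0 < D th /\ laplace th = (D th `^ (- b))%:E.
Hypothesis good_neg : forall th : 'rV[R]_d, (forall i, th 0 i <= 0) -> good th.

Let mexp (th : 'rV[R]_d) : measurable_fun setT (fun t => expR (\sum_i th 0 i * X t i)).
Proof.
apply: measurableT_comp => //; apply: measurable_sum => i.
exact: measurable_funM.
Qed.

Lemma laplace_le (th th' : 'rV[R]_d) : (forall i, th 0 i <= th' 0 i) ->
  (laplace th <= laplace th')%E.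
Proof.
move=> le; apply: ge0_le_integral => //.
- exact/measurable_EFinP.
- exact/measurable_EFinP.
- by move=> t _; rewrite lee_fin ler_expR ler_sum// => i _; rewrite ler_wpM2r.
Qed.

Let laplace_axis (th : 'rV[R]_d) i u :
  laplace (th + u *: axis R i) =
  (\int[m]_t (expR (\sum_i th 0 i * X t i) * expR (u * X t i))%:E)%E.
Proof.
apply: eq_integral => t _; rewrite -expRD; congr (expR _)%:E.
rewrite -[u * X t i]/(u * X t i); under eq_bigr => j _ do rewrite !mxE mulrDl.
rewrite big_split /=; congr (_ + _).
rewrite (bigD1 i)//= eqxx mulr1 big1 ?addr0// => j /negPf ji.
by rewrite ji mulr0 mul0r.
Qed.

(** Along the axis the determinant is [D th - v c]; [c >= 0], as otherwise it would vanish at some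
    [v <= 0]. For [v <= 0] the transform is that of [X' = c |y|^(1/b)] under the density [g'], and
    [laplace_determines_exp] carries the equality to [v = u], infinite values included. *)
Let laplace_line (th : 'rV[R]_d) i u : 0 < u ->
  (forall v, 0 <= v -> good (th + (- v) *: axis R i)) ->
  laplace (th + u *: axis R i) =
  ((gamma_cst b)^-1%:E * gamma_int b (D (th + u *: axis R i)))%E.
Proof.
move=> u0 H.
pose c := D th - D (th + axis R i).
have DE v : D (th + v *: axis R i) = D th - v * c.
  by rewrite /D det_diag_affine -!/(D _) /c; ring.
have D0 : 0 < D th by have [+ _] := H 0 (lexx 0); rewrite oppr0 scale0r addr0.
have c0 : 0 <= c.
  rewrite leNgt; apply/negP => cneg.
  have v0 : 0 <= - (D th / c) by rewrite oppr_ge0 mulr_ge0_le0 ?invr_le0 ?ltW.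
  have [+ _] := H _ v0; rewrite DE opprK divfK ?lt_eqF// subrr ltxx //.
have g0 := gamma_cst_gt0 b0.
pose g' (y : R) := (gamma_cst b)^-1 * expR (- (D th * `|y| `^ b^-1)).
pose X' (y : R) := c * `|y| `^ b^-1.
have mg' : measurable_fun setT g'.
  by apply: measurable_funM => //; exact: measurable_gamma_integrand.
have mX' : measurable_fun setT X'.
  by apply: measurable_funM => //; exact: measurable_abs_powR.
have gint v : (\int[@lebesgue_measure R]_y (g' y * expR (v * X' y))%:E =
    (gamma_cst b)^-1%:E * gamma_int b (D (th + v *: axis R i)))%E.
  rewrite /gamma_int -ge0_integralZl//; last 2 first.
  - by apply/measurable_EFinP; exact: measurable_gamma_integrand.
  - by rewrite lee_fin invr_ge0 ltW.
  apply: eq_integral => y _; rewrite -EFinM /g' -mulrA -expRD; congr (_ * expR _)%:E.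
  by rewrite DE /X'; ring.
rewrite laplace_axis -gint.
apply: (laplace_determines_exp (m' := @lebesgue_measure R)) => //.
- by move=> y; rewrite mulr_ge0 ?expR_ge0// invr_ge0 ltW.
- by move=> y; rewrite mulr_ge0 ?powR_ge0.
- have [_ +] := H 0 (lexx 0); rewrite oppr0 scale0r addr0 => Lth.
  by rewrite -/(laplace th) Lth ltry.
move=> j; have v0 : 0 <= j%:R * u by rewrite mulr_ge0// ltW.
have [Dj Lj] := H _ v0.
transitivity (laplace (th + (- (j%:R * u)) *: axis R i)).
  rewrite laplace_axis; apply: eq_integral => t _.
  by rewrite -expRM_natl; congr (_ * expR _)%:E; ring.
transitivity (\int[@lebesgue_measure R]_y (g' y * expR (- (j%:R * u) * X' y))%:E)%E.
  rewrite gint Lj gamma_intE// -EFinM; congr EFin.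
  by rewrite [RHS]mulrC mulfK// gt_eqF.
apply: eq_integral => y _.
by rewrite -expRM_natl; congr (_ * expR _)%:E; ring.
Qed.

Let good_line (th : 'rV[R]_d) i u : 0 <= u ->
  (forall v, 0 <= v -> good (th + (- v) *: axis R i)) ->
  (0 < D (th + u *: axis R i) \/ (laplace (th + u *: axis R i) < +oo)%E) ->
  good (th + u *: axis R i).
Proof.
rewrite le_eqVlt => /predU1P[<-|u0] H P.
  by have := H 0 (lexx 0); rewrite oppr0.
have L := laplace_line u0 H; have g0 := gamma_cst_gt0 b0.
have D0 : 0 < D (th + u *: axis R i).
  case: P => // Loo; rewrite ltNge; apply/negP => D0.
  by move: Loo; rewrite L gamma_int_pinfty// mulry gtr0_sg ?invr_gt0// mul1e.
split => //; rewrite L gamma_intE// -EFinM [in LHS]mulrC mulfK ?gt_eqF//.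
Qed.

(** Induction on [n], where only the first [n] coordinates may be positive. The last positive one is
    lowered to [0] and restored along its axis; every point below stays finite by monotonicity, so
    the induction hypothesis covers the half-line that [good_line] needs. *)
Lemma laplace_finite (th : 'rV[R]_d) : (laplace th < +oo)%E ->
  0 < D th /\ laplace th = (D th `^ (- b))%:E.
Proof.
move=> Loo; suff H n : forall th : 'rV[R]_d, (laplace th < +oo)%E ->
    (forall i : 'I_d, (n <= i)%N -> th 0 i <= 0) -> good th.
  by apply: (H d) => // i; rewrite leqNgt ltn_ord.
elim: n => [|n IH] {Loo}th Loo th0; first by apply: good_neg => i; exact: th0.
have [nd|nd] := ltnP n d; last first.
  by apply: IH => // i ni; have := leq_trans nd ni; rewrite leqNgt ltn_ord.
pose i := Ordinal nd; have [thi|thi] := leP (th 0 i) 0.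
  apply: IH => // j; rewrite leq_eqVlt => /predU1P[nj|]; last exact: th0.
  by rewrite (_ : j = i)//; apply/val_inj.
pose th' := th + (- th 0 i) *: axis R i.
have thE : th = th' + th 0 i *: axis R i by rewrite /th' -addrA -scalerDl addNr scale0r addr0.
rewrite thE; apply: good_line; [exact: ltW| |by right; rewrite -thE].
have le_th v : 0 <= v -> forall j, (th' + (- v) *: axis R i) 0 j <= th 0 j.
  move=> v0 j; rewrite /th' !mxE !eqxx /=.
  case: eqP => _; last by rewrite !mulr0 !addr0.
  by rewrite !mulr1 -addrA gerDl -opprD oppr_le0 addr_ge0// ltW.
move=> v v0; apply: IH.
  by apply: le_lt_trans Loo; apply: laplace_le; exact: le_th.
move=> j; rewrite leq_eqVlt => /predU1P[nj|nj].
  rewrite (_ : j = i); last exact/val_inj.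
  by rewrite /th' !mxE !eqxx /= !mulr1 subrr add0r oppr_le0.
by apply: le_trans (th0 _ nj); exact: le_th.
Qed.

Lemma laplace_extend (th : 'rV[R]_d) i u : (laplace th < +oo)%E -> 0 <= u ->
  0 < D (th + u *: axis R i) -> (laplace (th + u *: axis R i) < +oo)%E.
Proof.
move=> Loo u0 D0.
have [_ ->] : good (th + u *: axis R i); last by rewrite ltry.
apply: good_line => //; last by left.
move=> v v0; apply: laplace_finite; apply: le_lt_trans Loo; apply: laplace_le => j.
by rewrite !mxE gerDl mulNr oppr_le0 mulr_ge0.
Qed.

End Extension.

(** * The class of Laplace transforms *)

Section VectorSpace.
Variables (R : realType) (d : nat).

Definition cylinders : set (set ('I_d -> R)) :=
  [set A | exists (i : 'I_d) (B : set R), measurable B /\ A = [set f | B (f i)]].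

(** Turns [rvec_borel] into the sigma-algebra of a measurable type, on which measures can be
    built. *)
Definition rvec := g_sigma_algebraType cylinders.

HB.instance Definition _ := Measurable.on rvec.

Lemma measurable_coord (i : 'I_d) : measurable_fun setT (fun f : rvec => f i).
Proof.
move=> _ B mB; rewrite setTI; apply: sub_sigma_algebra; exists i, B; split => //.
Qed.

Lemma measurable_to_rvec dT (T : measurableType dT) (X : T -> 'I_d -> R) :
  random_vector X -> measurable_fun setT (X : T -> rvec).
Proof.
move=> mX; apply: (@measurability _ _ T rvec setT X cylinders) => //.
move=> _ [_ [i [B [mB ->]]] <-]; rewrite setTI.
by rewrite -[X in measurable X]setTI; exact: (mX i).
Qed.

End VectorSpace.

Section Density.
Local Open Scope ereal_scope.
Context dT (T : measurableType dT) (R : realType).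
Variables (m : {measure set T -> \bar R}) (w : T -> R).
Hypothesis mw : measurable_fun setT w.
Hypothesis w0 : forall t, (0 <= w t)%R.

(** The two proofs are arguments so that the measure structure can be attached to the resulting
    term. *)
Definition mdensity (_ : measurable_fun setT w) (_ : forall t, (0 <= w t)%R)
  (A : set T) := \int[m]_(t in A) (w t)%:E.

Local Notation dens := (mdensity mw w0).

Let dens0 : dens set0 = 0. Proof. by rewrite /mdensity integral_set0. Qed.

Let dens_ge0 A : 0 <= dens A.
Proof. by apply: integral_ge0 => t _; rewrite lee_fin. Qed.

Let dens_sigma_additive : semi_sigma_additive dens.
Proof.
move=> /= F mF tF mUF; rewrite /mdensity; apply: cvg_toP.
  apply: ereal_nondecreasing_is_cvgn => i j ij.
  by apply: lee_sum_nneg_natr => // k _ _; apply: integral_ge0 => /= x _; rewrite lee_fin.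
rewrite ge0_integral_bigcup//=.
- by apply/measurable_EFinP; exact: measurable_funTS.
- by move=> x _; rewrite lee_fin.
Qed.

HB.instance Definition _ := isMeasure.Build _ _ _ dens dens0 dens_ge0 dens_sigma_additive.

Import HBNNSimple.

(** Checked on indicators, extended to simple functions by linearity, then to nonnegative functions
    by monotone convergence. *)
Lemma density_measure : exists m' : {measure set T -> \bar R},
  forall f : T -> \bar R, measurable_fun setT f -> (forall t, 0 <= f t) ->
    \int[m']_t f t = \int[m]_t (f t * (w t)%:E).
Proof.
exists dens => f mf f0.
pose h := nnsfun_approx measurableT mf.
have cvgh t : (h n t)%:E @[n --> \oo] --> f t by exact: cvg_nnsfun_approx.
transitivity (limn (fun n => \int[dens]_t (h n t)%:E)).
  rewrite -monotone_convergence//.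
  - by apply: eq_integral => t _; apply/esym/cvg_lim => //; exact: cvgh.
  - by move=> n; exact/measurable_EFinP.
  - by move=> n t _; rewrite lee_fin.
  - by move=> t _ a b ab; rewrite lee_fin; exact/lefP/nd_nnsfun_approx.
transitivity (limn (fun n => \int[m]_t ((h n t)%:E * (w t)%:E))); last first.
  rewrite -monotone_convergence//.
  - apply: eq_integral => t _; apply/cvg_lim => //.
    by apply: cvgeZr => //; exact: cvgh.
  - by move=> n; apply: emeasurable_funM; exact/measurable_EFinP.
  - by move=> n t _; rewrite -EFinM lee_fin mulr_ge0.
  - by move=> t _ a b ab; rewrite lee_wpmul2r ?lee_fin//; exact/lefP/nd_nnsfun_approx.
congr (limn _); apply/funext => n.
have mind r : measurable (h n @^-1` [set r]) by [].
transitivity (\sum_(y \in range (h n)) \int[dens]_x (y * \1_(h n @^-1` [set y]) x)%:E).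
  rewrite -ge0_integral_fsum//.
  - by apply: eq_integral => t tE; rewrite /= fimfunE -fsumEFin.
  - by move=> y; apply/measurable_EFinP; exact: measurable_funM.
  - by move=> y x _; exact: nnfun_muleindic_ge0.
transitivity (\sum_(y \in range (h n))
    \int[m]_x ((y * \1_(h n @^-1` [set y]) x)%:E * (w x)%:E)); last first.
  rewrite -ge0_integral_fsum//.
  - apply: eq_integral => t tE; rewrite -ge0_mule_fsuml => [|y]; last exact: nnfun_muleindic_ge0.
    by rewrite fsumEFin // -(fimfunE _ t).
  - move=> y; apply: emeasurable_funM; last exact/measurable_EFinP.
    by apply/measurable_EFinP; exact: measurable_funM.
  - by move=> y x _; rewrite mule_ge0 ?lee_fin//; exact: nnfun_muleindic_ge0.
apply: eq_fsbigr => r rhn.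
have r0 : (0 <= r)%R by move: rhn; rewrite inE => -[t _ <-].
under eq_integral do rewrite EFinM.
rewrite integralZl_indic_nnsfun// integral_indic// setIT.
under eq_integral do rewrite -muleA.
rewrite ge0_integralZl//.
- congr (_ * _); rewrite /= /mdensity integral_mkcond; apply: eq_integral => t _.
  by rewrite patchE indicE; case: ifPn => _; rewrite ?mul1e ?mul0e.
- by apply: emeasurable_funM; exact/measurable_EFinP.
- by move=> t _; rewrite mule_ge0 ?lee_fin.
Qed.

End Density.

Section FiniteMeasureOf.
Variables (dT : measure_display) (T : measurableType dT) (R : realType).
Variable m : {measure set T -> \bar R}.
Hypothesis moo : (m setT < +oo)%E.

Definition mbounded of (m setT < +oo)%E : set T -> \bar R := m.

Local Notation fm := (mbounded moo).

HB.instance Definition _ := Measure.on fm.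

Let fm_fin : fin_num_fun fm.
Proof.
move=> A mA; rewrite ge0_fin_numE//; apply: le_lt_trans moo.
by apply: le_measure; rewrite ?inE.
Qed.

HB.instance Definition _ := Measure_isFinite.Build _ _ _ fm fm_fin.

Lemma finite_measure_of :
  exists m' : {finite_measure set T -> \bar R}, forall A, m' A = m A.
Proof. by exists fm. Qed.
End FiniteMeasureOf.

Section LaplaceClass.
Variables (R : realType) (d : nat).
Implicit Types (phi : 'rV[R]_d -> R) (al : 'rV[R]_d).

Definition nonneg_rv al := forall i, 0 <= al 0 i.

(** Absolute values make the coordinates nonnegative on the whole space, so no condition on the
    support of a measure has to be carried along. *)
Definition absv (f : rvec R d) (i : 'I_d) : R := `|f i|.

Lemma measurable_absv i : measurable_fun setT (fun f => absv f i).
Proof. by apply: measurableT_comp => //; exact: measurable_coord. Qed.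

Definition is_laplace phi := exists m : {finite_measure set (rvec R d) -> \bar R},
  forall al, nonneg_rv al -> laplace m absv (- al) = (phi al)%:E.

Lemma measurable_expsum dT (T : measurableType dT) (X : T -> 'I_d -> R) al :
  random_vector X -> measurable_fun setT (fun t => (expR (\sum_i al 0 i * X t i))%:E).
Proof.
move=> mX; apply/measurable_EFinP; apply: measurableT_comp => //.
by apply: measurable_sum => i; apply: measurable_funM => //; exact: mX.
Qed.

Lemma laplace0 dT (T : measurableType dT) (m : {measure set T -> \bar R})
  (X : T -> 'I_d -> R) : laplace m X 0 = m setT.
Proof.
rewrite /laplace (eq_integral (cst 1%E)).
  by rewrite integral_cst// mul1e.
by move=> t _; rewrite big1 ?expR0// => i _; rewrite mxE mul0r.
Qed.

(** The measure is pushed forward along [X]; its total mass is [phi 0], hence finite. *)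
Lemma is_laplace_transfer dT (T : measurableType dT) (m : {measure set T -> \bar R})
  (X : T -> 'I_d -> R) phi : random_vector X -> (forall t i, 0 <= X t i) ->
  (forall al, nonneg_rv al -> laplace m X (- al) = (phi al)%:E) -> is_laplace phi.
Proof.
move=> mX X0 H.
have mXv := measurable_to_rvec mX.
pose pm0 : {measure set (rvec R d) -> \bar R} := pushforward m (X : T -> rvec R d).
pose pm := pm0 mXv.
have pmoo : (pm setT < +oo)%E.
  rewrite /pm /pm0 /= /pushforward preimage_setT -(laplace0 m X) -oppr0 H ?ltry// => i.
  by rewrite mxE.
have [m' m'E] := finite_measure_of pmoo.
exists m' => al al0; rewrite -H// /laplace.
rewrite (@eq_measure_integral _ _ _ _ pm); last by move=> A _ _; exact: m'E.
rewrite ge0_integral_pushforward//.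
- apply: eq_integral => t _ /=; congr (expR _)%:E; apply: eq_bigr => i _.
  by rewrite /absv ger0_norm.
- by apply: measurable_expsum; exact: measurable_absv.
Qed.

Lemma is_laplace_ge0 phi al : is_laplace phi -> nonneg_rv al -> 0 <= phi al.
Proof.
move=> [m H] al0; rewrite -lee_fin -H//.
by apply: integral_ge0 => t _; rewrite lee_fin expR_ge0.
Qed.

Lemma eq_is_laplace phi psi : (forall al, nonneg_rv al -> phi al = psi al) ->
  is_laplace phi -> is_laplace psi.
Proof. by move=> e [m H]; exists m => al al0; rewrite H// e. Qed.

Lemma is_laplace_cst c : 0 <= c -> is_laplace (fun=> c).
Proof.
move=> c0; pose cn : {nonneg R} := NngNum c0.
apply: (@is_laplace_transfer _ (rvec R d) (mscale cn \d_((fun=> 0) : rvec R d)) absv).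
- exact: measurable_absv.
- by move=> t i; rewrite /absv.
move=> al _; rewrite /laplace ge0_integral_mscale//.
- rewrite integral_dirac//= ?diracT ?mul1e.
    by rewrite big1 ?expR0 ?mule1// => i _; rewrite /absv normr0 mulr0.
  by apply: measurable_expsum; exact: measurable_absv.
- by apply: measurable_expsum; exact: measurable_absv.
Qed.

Lemma is_laplaceD phi psi : is_laplace phi -> is_laplace psi ->
  is_laplace (fun al => phi al + psi al).
Proof.
move=> [m1 H1] [m2 H2].
apply: (@is_laplace_transfer _ (rvec R d) (measure_add m1 m2) absv).
- exact: measurable_absv.
- by move=> t i; rewrite /absv.
move=> al al0; rewrite /laplace ge0_integral_measure_add//.
- by rewrite -!/(laplace _ _ _) H1// H2.
- by apply: measurable_expsum; exact: measurable_absv.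
Qed.

(** Convolution: the product measure carries the sum of the two vectors, and Tonelli separates the
    integral. *)
Lemma is_laplaceM phi psi : is_laplace phi -> is_laplace psi ->
  is_laplace (fun al => phi al * psi al).
Proof.
move=> [m1 H1] [m2 H2].
pose X (t : rvec R d * rvec R d) i := absv t.1 i + absv t.2 i.
have mX : random_vector X.
  move=> i; apply: measurable_funD.
  - by apply: (measurableT_comp (measurable_absv i)).
  - by apply: (measurableT_comp (measurable_absv i)).
apply: (@is_laplace_transfer _ _ (m1 \x m2)%E X) => //.
  by move=> t i; apply: addr_ge0; exact: normr_ge0.
move=> al al0; rewrite /laplace fubini_tonelli1//=; last first.
  by apply: measurable_expsum.
rewrite /fubini_F.
transitivity (\int[m1]_f ((expR (\sum_i (- al) 0 i * absv f i))%:E * (psi al)%:E))%E.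
  apply: eq_integral => f _; rewrite -H2//.
  rewrite /laplace -ge0_integralZl//; last first.
    by apply: measurable_expsum; exact: measurable_absv.
  apply: eq_integral => g _; rewrite -EFinM -expRD; congr (expR _)%:E.
  by rewrite -big_split; apply: eq_bigr => i _; rewrite /X /= mulrDr.
rewrite ge0_integralZr//.
- by rewrite -/(laplace _ _ _) H1.
- by apply: measurable_expsum; exact: measurable_absv.
- by rewrite lee_fin (@is_laplace_ge0 psi)//; exists m2.
Qed.

Lemma is_laplaceZ c phi : 0 <= c -> is_laplace phi -> is_laplace (fun al => c * phi al).
Proof. by move=> c0; apply: is_laplaceM; exact: is_laplace_cst. Qed.

Lemma is_laplaceX n phi : is_laplace phi -> is_laplace (fun al => phi al ^+ n).
Proof.
move=> Hphi; elim: n => [|n IH].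
  apply: eq_is_laplace (is_laplace_cst ler01) => al _; by rewrite expr0.
by apply: eq_is_laplace (is_laplaceM Hphi IH) => al _; rewrite exprS.
Qed.

Lemma is_laplace_sum (I : Type) (s : seq I) (F : I -> 'rV[R]_d -> R) :
  (forall i, is_laplace (F i)) -> is_laplace (fun al => \sum_(i <- s) F i al).
Proof.
move=> HF; elim: s => [|i s IH].
  by apply: eq_is_laplace (is_laplace_cst (lexx 0)) => al _; rewrite big_nil.
by apply: eq_is_laplace (is_laplaceD (HF i) IH) => al _; rewrite big_cons.
Qed.

Lemma is_laplace_gamma i (k b : R) : 0 < b -> 0 < k ->
  is_laplace (fun al => (k + al 0 i) `^ (- b)).
Proof.
move=> b0 k0; have g0 := gamma_cst_gt0 b0.
pose w (u : R) := (gamma_cst b)^-1 * expR (- (k * `|u| `^ b^-1)).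
have mw : measurable_fun setT w.
  by apply: measurable_funM => //; exact: measurable_gamma_integrand.
have w0 u : 0 <= w u by rewrite mulr_ge0 ?expR_ge0// invr_ge0 ltW.
have [m mE] := density_measure (@lebesgue_measure R) mw w0.
pose X (u : R) (j : 'I_d) := `|u| `^ b^-1 * (j == i)%:R.
have mX : random_vector X.
  by move=> j; apply: measurable_funM => //; exact: measurable_abs_powR.
apply: (@is_laplace_transfer _ _ m X) => //.
  by move=> u j; rewrite mulr_ge0 ?powR_ge0.
move=> al al0; rewrite /laplace mE; last 2 first.
- exact: measurable_expsum.
- by move=> t; rewrite lee_fin expR_ge0.
transitivity ((gamma_cst b)^-1%:E * gamma_int b (k + al ord0 i))%E; last first.
  by rewrite gamma_intE ?ltr_wpDr// -EFinM mulrCA mulVf ?mulr1// gt_eqF.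
rewrite /gamma_int -ge0_integralZl//; last 2 first.
- by apply/measurable_EFinP; exact: measurable_gamma_integrand.
- by rewrite lee_fin invr_ge0 ltW.
apply: eq_integral => u _; rewrite -!EFinM /w mulrCA -expRD; congr (_ * expR _)%:E.
rewrite (bigD1 i)//= /X eqxx mulr1 big1 ?addr0.
  by rewrite mxE; ring.
by move=> j /negPf ->; rewrite !mulr0.
Qed.

(* [(1 - r)^(-b)] is a power series in [r] with nonnegative coefficients, as
   the mixture of the [e^(r t)] over a gamma variable [t]. *)
Lemma binomial_series (b : R) : 0 < b -> exists K : nat -> R,
  (forall n, 0 <= K n) /\ forall r, 0 <= r < 1 ->
    (\sum_(n <oo) (K n * r ^+ n)%:E = ((1 - r) `^ (- b))%:E)%E.
Proof.
move=> b0; have g0 := gamma_cst_gt0 b0.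
pose t (u : R) := `|u| `^ b^-1.
have t0 u : 0 <= t u by exact: powR_ge0.
have mt : measurable_fun setT t by exact: measurable_abs_powR.
pose k n (u : R) := (gamma_cst b)^-1 * expR (- (1 * t u)) * (t u ^+ n / n`!%:R).
have mk n : measurable_fun setT (k n).
  apply: measurable_funM; last by apply: measurable_funM => //; exact: measurable_funX.
  by apply: measurable_funM => //; exact: measurable_gamma_integrand.
have k0 n u : 0 <= k n u.
  by rewrite !mulr_ge0 ?expR_ge0 ?invr_ge0 ?exprn_ge0// ltW.
pose KE n := (\int[@lebesgue_measure R]_u (k n u)%:E)%E.
have KE0 n : (0 <= KE n)%E by apply: integral_ge0 => u _; rewrite lee_fin.
have sumE r : 0 <= r < 1 -> (\sum_(n <oo) (KE n * (r ^+ n)%:E) = ((1 - r) `^ (- b))%:E)%E.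
  move=> /andP[r0 r1].
  transitivity ((gamma_cst b)^-1%:E * gamma_int b (1 - r))%E; last first.
    by rewrite gamma_intE ?subr_gt0// -EFinM mulrCA mulVf ?mulr1// gt_eqF.
  transitivity (\sum_(n <oo) \int[@lebesgue_measure R]_u (k n u * r ^+ n)%:E)%E.
    apply: eq_eseriesr => n _; rewrite /KE -ge0_integralZr//.
    - by apply/measurable_EFinP; exact: mk.
    - by move=> u _; rewrite lee_fin; exact: k0.
    - by rewrite lee_fin exprn_ge0.
  rewrite -integral_nneseries//; last 2 first.
  - by move=> n; apply/measurable_EFinP; apply: measurable_funM => //; exact: mk.
  - by move=> n u _; rewrite lee_fin mulr_ge0 ?exprn_ge0//; exact: k0.
  rewrite /gamma_int -ge0_integralZl//; last 2 first.
  - by apply/measurable_EFinP; exact: measurable_gamma_integrand.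
  - by rewrite lee_fin invr_ge0 ltW.
  apply: eq_integral => u _; apply/cvg_lim => //.
  rewrite [X in X @ _](_ : _ = EFin \o
    (fun n => ((gamma_cst b)^-1 * expR (- (1 * t u))) *
       series (exp_coeff (r * t u)) n)); last first.
    apply/funext => n /=; rewrite sumEFin; congr EFin.
    rewrite /series /= mulr_sumr; apply: eq_bigr => i _.
    by rewrite /k /exp_coeff /= exprMn; ring.
  apply: cvg_EFin; first exact: nearW.
  have -> : (gamma_cst b)^-1 * expR (- ((1 - r) * `|u| `^ b^-1)) =
     (gamma_cst b)^-1 * expR (- (1 * t u)) * expR (r * t u).
    by rewrite -mulrA -expRD /t; congr (_ * expR _); ring.
  apply: cvgMr; exact: is_cvg_series_exp_coeff.
(* An infinite coefficient would make the series infinite at [r = 1/2], where its sum is known to be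
   finite. *)
have KEfin n : KE n \is a fin_num.
  rewrite ge0_fin_numE// ltNge leye_eq; apply/negP => /eqP Koo.
  have h01 : 0 <= (2^-1 : R) < 1 by rewrite invr_ge0 ler0n /= invf_lt1// ltr1n.
  have := sumE _ h01; rewrite (@nneseries_pinfty _ _ _ n)//.
  - by move=> k' _; rewrite mule_ge0// lee_fin exprn_ge0// invr_ge0.
  - by rewrite Koo mulyr gtr0_sg ?mul1e// exprn_gt0// invr_gt0.
exists (fun n => fine (KE n)); split; first by move=> n; rewrite fine_ge0.
by move=> r r01; rewrite -sumE//; apply: eq_eseriesr => n _; rewrite EFinM fineK.
Qed.

(** The series of [(1 - r)^(-b)] at [r = phi al] is realised by a weighted sum of measures with
    transforms [phi^n]. *)
Lemma is_laplace_binomial phi (b : R) : 0 < b -> is_laplace phi ->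
  (forall al, nonneg_rv al -> phi al < 1) ->
  is_laplace (fun al => (1 - phi al) `^ (- b)).
Proof.
move=> b0 Hphi phi1; have [K [K0 KE]] := binomial_series b0.
have ex n : exists m : {finite_measure set (rvec R d) -> \bar R}, forall al,
    nonneg_rv al -> laplace m absv (- al) = (phi al ^+ n)%:E by exact: is_laplaceX.
have [m_ mE] := choice ex.
pose Kn n : {nonneg R} := NngNum (K0 n).
pose mm n : {measure set (rvec R d) -> \bar R} := mscale (Kn n) (m_ n).
apply: (@is_laplace_transfer _ (rvec R d) (mseries mm 0) absv).
- exact: measurable_absv.
- by move=> t i; rewrite /absv.
move=> al al0; rewrite -KE; last by rewrite phi1// (is_laplace_ge0 Hphi al0).
have me : measurable_fun setT
   (fun t : rvec R d => (expR (\sum_i (- al) 0 i * absv t i))%:E).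
  by apply: measurable_expsum; exact: measurable_absv.
rewrite /laplace ge0_integral_measure_series//.
apply: eq_eseriesr => n _; rewrite /mm ge0_integral_mscale//=.
by rewrite -/(laplace _ _ _) mE.
Qed.

End LaplaceClass.
Arguments absv {R d}.

(** * Rank-one updates of determinants and inverses *)

Section RankOne.
Variables (R : fieldType) (n : nat).
Implicit Types (H : 'M[R]_n) (b : 'rV[R]_n).

Lemma invmx_unique H K : H *m K = 1%:M -> invmx H = K.
Proof.
move=> HK; have [uH _] := mulmx1_unit HK.
by apply: (can_inj (mulKmx uH)); rewrite mulmxV.
Qed.

Let rho H b k := (b *m invmx H) 0 k.

Let rhoE H b (k : 'I_n) : b *m (invmx H *m delta_mx k 0) = (rho H b k)%:M.
Proof.
apply/matrixP => x y; rewrite !ord1 mulmxA /rho; move: (b *m invmx H) => c.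
rewrite !mxE eqxx mulr1n (bigD1 k)//= mxE !eqxx mulr1.
by rewrite big1 ?addr0// => j /negPf jk; rewrite mxE jk mulr0.
Qed.

Lemma det_rank1 H b (k : 'I_n) : H \in unitmx ->
  \det (H - delta_mx k 0 *m b) = \det H * (1 - rho H b k).
Proof.
move=> uH.
have -> : H - delta_mx k 0 *m b = H *m (1%:M + invmx H *m (- delta_mx k 0) *m b).
  by rewrite mulmxDr mulmx1 !mulmxA mulmxV// mul1mx mulNmx.
rewrite det_mulmx det_addmulmxC !mulmxN rhoE -raddfB.
by rewrite det_scalar expr1.
Qed.

(** The Sherman-Morrison formula for a change of the single row [k]. *)
Lemma invmx_rank1 H b (k : 'I_n) : H \in unitmx -> rho H b k != 1 ->
  invmx (H - delta_mx k 0 *m b) =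
  \matrix_(i, j) (invmx H i j +
     (1 - rho H b k)^-1 * (invmx H i k * (b *m invmx H) 0 j)).
Proof.
move=> uH r1; have r0 : 1 - rho H b k != 0 by rewrite subr_eq0 eq_sym.
apply: invmx_unique.
have -> : \matrix_(i, j) (invmx H i j +
     (1 - rho H b k)^-1 * (invmx H i k * (b *m invmx H) 0 j)) =
  invmx H + (1 - rho H b k)^-1 *: (invmx H *m (delta_mx k 0 *m (b *m invmx H))).
  move: (invmx H) (b *m invmx H) (rho H b k) => K c r.
  apply/matrixP => i j; rewrite mxE [RHS]mxE; congr (_ + _).
  rewrite [RHS]mxE; congr (_ * _).
  rewrite [RHS]mxE (bigD1 k)//= big1 ?addr0.
    by rewrite [X in _ = _ * X]mxE big_ord_recl big_ord0 addr0 [delta_mx _ _ _ _]mxE !eqxx mul1r.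
  move=> l /negPf lk; rewrite [X in _ * X]mxE big_ord_recl big_ord0 addr0 [delta_mx _ _ _ _]mxE lk.
  by rewrite mul0r mulr0.
rewrite mulmxDr !mulmxBl mulmxV// -!scalemxAr mulKVmx//.
rewrite -[delta_mx k 0 *m b *m _]mulmxA.
rewrite -[delta_mx k 0 *m b *m _]mulmxA.
have -> : b *m (invmx H *m (delta_mx k 0 *m (b *m invmx H))) =
    rho H b k *: (b *m invmx H).
  by rewrite !mulmxA -(mulmxA b) rhoE mul_scalar_mx scalemxAl.
rewrite -scalemxAr; move: (delta_mx k 0 *m (b *m invmx H)) => Q.
rewrite -scalerBr -{2}[Q]scale1r -scalerBl scalerA mulVf// scale1r.
by rewrite subrK.
Qed.

End RankOne.

Section ZMatrixLaplace.
Variables (R : realType) (d : nat).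
Implicit Types (al : 'rV[R]_d).

Lemma is_laplace_prod (I : Type) (s : seq I) (F : I -> 'rV[R]_d -> R) :
  (forall i, is_laplace (F i)) -> is_laplace (fun al => \prod_(i <- s) F i al).
Proof.
move=> HF; elim: s => [|i s IH].
  by apply: eq_is_laplace (is_laplace_cst _ ler01) => al _; rewrite big_nil.
by apply: eq_is_laplace (is_laplaceM (HF i) IH) => al _; rewrite big_cons.
Qed.

Lemma powR_prod (I : Type) (s : seq I) (F : I -> R) (b : R) : (forall i, 0 <= F i) ->
  (\prod_(i <- s) F i) `^ b = \prod_(i <- s) F i `^ b.
Proof.
move=> F0; elim: s => [|i s IH]; first by rewrite !big_nil powR1.
by rewrite !big_cons powRM ?IH// prodr_ge0.
Qed.

Variables (B : 'M[R]_d) (k : R).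
Hypothesis B0 : forall i j, 0 <= B i j.
Hypothesis k0 : 0 < k.
Hypothesis Bk : forall i, \sum_j B i j <= k / 4.

Let Hm (m : nat) al : 'M[R]_d :=
  diag_mx (const_mx k + al) - \matrix_(i, j) (B i j *+ (i < m)%N).

Let HmS m (im : (m < d)%N) al :
  Hm m.+1 al = Hm m al - delta_mx (Ordinal im) 0 *m row (Ordinal im) B.
Proof.
apply/matrixP => i j; rewrite !mxE big_ord_recl big_ord0 !mxE addr0 eqxx andbT.
rewrite -addrA -opprD; congr (_ - _); rewrite ltnS leq_eqVlt.
have -> : (i == Ordinal im) = (val i == m) by [].
by case: (ltngtP (val i) m) => // H; rewrite ?mulr0n ?mulr1n ?mul0r ?addr0 ?mul1r ?add0r//;
  congr (B _ _); apply/val_inj.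
Qed.

(** The rows of [B] are subtracted one by one, with the invariant that the entries of the inverse
    are Laplace transforms too. Each step multiplies the determinant by [1 - rho] with [rho] a
    transform below [1], and [is_laplace_binomial] handles the powers of this factor. *)
Lemma is_laplace_dominant (b : R) : 0 < b ->
  (forall al, nonneg_rv al -> 0 < \det (diag_mx (const_mx k + al) - B)) /\
  is_laplace (fun al => \det (diag_mx (const_mx k + al) - B) `^ (- b)).
Proof.
move=> b0.
suff H m : (m <= d)%N -> [/\ forall al, nonneg_rv al -> 0 < \det (Hm m al),
    forall i j, is_laplace (fun al => invmx (Hm m al) i j) &
    is_laplace (fun al => \det (Hm m al) `^ (- b))].
  have [H1 _ H3] := H d (leqnn d).
  have E al : Hm d al = diag_mx (const_mx k + al) - B.
    by congr (_ - _); apply/matrixP => i j; rewrite mxE ltn_ord.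
  split; first by move=> al al0; rewrite -E H1.
  by apply: eq_is_laplace H3 => al _; rewrite E.
have kal al i : nonneg_rv al -> 0 < k + al 0 i by move=> al0; rewrite ltr_wpDr.
elim: m => [|m IH] md.
  have E al : Hm 0 al = diag_mx (const_mx k + al).
    by rewrite /Hm [X in _ - X](_ : _ = 0) ?subr0//; apply/matrixP => i j; rewrite !mxE.
  split.
  - move=> al al0; rewrite E det_diag; apply: prodr_gt0 => i _.
    by rewrite !mxE kal.
  - move=> i j.
    apply: eq_is_laplace (is_laplaceZ (ler0n _ (i == j)) (is_laplace_gamma i ltr01 k0)).
    move=> al al0; rewrite E (@invmx_unique _ _ _
        (\matrix_(i, j) ((i == j)%:R * (k + al 0 i)^-1))).
      by rewrite [RHS]mxE powR_inv1// ltW// kal.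
    apply/matrixP => x y; rewrite mul_diag_mx !mxE mulrCA divff ?mulr1//.
    by rewrite gt_eqF// kal.
  - have := @is_laplace_prod _ (index_enum 'I_d) _ (fun i => is_laplace_gamma i b0 k0).
    apply: eq_is_laplace => al al0; rewrite E det_diag.
    rewrite -powR_prod; last by move=> i; rewrite ltW// kal.
    by congr (_ `^ _); apply: eq_bigr => i _; rewrite !mxE.
have [D0 I0 L0] := IH (ltnW md).
pose o := Ordinal md; pose rho al := (row o B *m invmx (Hm m al)) 0 o.
have uH al : nonneg_rv al -> Hm m al \in unitmx.
  by move=> al0; rewrite unitmxE unitfE gt_eqF// D0.
have Lrow j : is_laplace (fun al => (row o B *m invmx (Hm m al)) 0 j).
  have := @is_laplace_sum R d _ (index_enum 'I_d) (fun l al => B o l * invmx (Hm m al) l j).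
  move=> /(_ (fun l => is_laplaceZ (B0 o l) (I0 l j))).
  by apply: eq_is_laplace => al _; rewrite mxE; apply: eq_bigr => l _; rewrite mxE.
(* The inverse has nonnegative entries, and every row of [Hm m al] sums to at least [k / 2], so
   [H^-1 (H 1) = 1] bounds each entry by [2 / k]. With row sums of [B] at most [k / 4], this gives
   [rho <= 1/2]. *)
have inv_le al i j : nonneg_rv al -> invmx (Hm m al) i j <= 2 / k.
  move=> al0.
  have e1 : \sum_j invmx (Hm m al) i j * \sum_l Hm m al j l = 1.
    under eq_bigr => l _ do rewrite mulr_sumr.
    rewrite exchange_big /=.
    transitivity (\sum_l (invmx (Hm m al) *m Hm m al) i l).
      by apply: eq_bigr => l _; rewrite [RHS]mxE.
    rewrite mulVmx ?uH// (bigD1 i)//= mxE eqxx big1 ?addr0// => l /negPf li.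
    by rewrite mxE eq_sym li.
  have row_ge l : k / 2 <= \sum_l' Hm m al l l'.
    have -> : \sum_l' Hm m al l l' = k + al 0 l - \sum_l' (B l l' *+ (l < m)%N).
      under eq_bigr => l' _ do rewrite !mxE.
      rewrite big_split /= sumrN; congr (_ - _).
      rewrite (bigD1 l)//= eqxx big1 ?addr0 ?mulr1n// => l' /negPf ll.
      by rewrite eq_sym ll mulr0n.
    have : \sum_l' (B l l' *+ (l < m)%N) <= k / 4.
      apply: le_trans (Bk l); apply: ler_sum => l' _.
      by case: (l < m)%N; rewrite ?mulr1n ?mulr0n.
    by have := al0 l; have := k0; lra.
  have Hge l : 0 <= invmx (Hm m al) i l by apply: (is_laplace_ge0 (I0 i l)).
  rewrite ler_pdivlMr//.
  suff : invmx (Hm m al) i j * (k / 2) <= 1 by lra.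
  rewrite -[leRHS]e1 (bigD1 j)//= ler_wpDr//.
    apply: sumr_ge0 => l _; rewrite mulr_ge0//; apply: le_trans (row_ge l).
    by rewrite divr_ge0// ltW.
  by apply: ler_wpM2l; [exact: Hge|exact: row_ge].
have rho_lt1 al : nonneg_rv al -> rho al < 1.
  move=> al0; apply: (@le_lt_trans _ _ (\sum_l B o l * (2 / k))).
    rewrite /rho mxE; apply: ler_sum => l _; rewrite mxE; apply: ler_wpM2l => //.
    exact: inv_le.
  rewrite -mulr_suml; apply: (@le_lt_trans _ _ (k / 4 * (2 / k))).
    by rewrite ler_wpM2r// divr_ge0// ltW.
  have -> : k / 4 * (2 / k) = 2^-1 by field; rewrite gt_eqF.
  by rewrite invf_lt1// ltr1n.
have one_rho al : nonneg_rv al -> 0 < 1 - rho al by move=> al0; rewrite subr_gt0 rho_lt1.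
split.
- by move=> al al0; rewrite (HmS md) det_rank1 ?uH// mulr_gt0 ?D0// one_rho.
- move=> i j.
  have L1 := is_laplace_binomial ltr01 (Lrow o) rho_lt1.
  apply: eq_is_laplace (is_laplaceD (I0 i j) (is_laplaceM L1 (is_laplaceM (I0 i o) (Lrow j)))).
  move=> al al0; rewrite (HmS md) invmx_rank1 ?uH//.
    by rewrite [RHS]mxE powR_inv1// ltW// one_rho.
  by rewrite lt_eqF// rho_lt1.
- have L1 := is_laplace_binomial b0 (Lrow o) rho_lt1.
  apply: eq_is_laplace (is_laplaceM L0 L1) => al al0.
  rewrite (HmS md) det_rank1 ?uH// powRM//; first by rewrite ltW// D0.
  by rewrite ltW// one_rho.
Qed.

End ZMatrixLaplace.

Lemma is_laplace_Zmatrix (R : realType) d (M : 'M[R]_d) (b : R) : 0 < b ->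
  (forall i j, i != j -> M i j <= 0) ->
  (forall al, nonneg_rv al -> 0 < \det (M + diag_mx al)) ->
  is_laplace (fun al => \det (M + diag_mx al) `^ (- b)).
Proof.
move=> b0 Moff Mdet.
(* [c] exceeds every diagonal entry in absolute value or equals it, so [B = c - M] is nonnegative;
   [l] is then taken large enough for the row sums of [B] to be at most [(c + l) / 4]. *)
pose c : R := \sum_i `|M i i|; pose B : 'M[R]_d := c%:M - M.
have c0 : 0 <= c by exact: sumr_ge0.
have B0 i j : 0 <= B i j.
  rewrite !mxE; have [->|ij] := eqVneq i j; last by rewrite mulr0n sub0r oppr_ge0 Moff.
  rewrite mulr1n subr_ge0 /c (bigD1 j)//= (le_trans (ler_norm _))// lerDl.
  exact: sumr_ge0.
pose S := \sum_i \sum_j B i j.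
have S0 : 0 <= S by apply: sumr_ge0 => i _; apply: sumr_ge0.
pose l := 4 * S + 1; pose k := c + l.
have l0 : 0 < l by rewrite /l ltr_wpDl// mulr_ge0.
have k0 : 0 < k by rewrite ltr_wpDl.
have Bk i : \sum_j B i j <= k / 4.
  rewrite ler_pdivlMr// /k /l; apply: (@le_trans _ _ (S * 4)).
    rewrite ler_wpM2r// /S [leRHS](bigD1 i)//= lerDl; apply: sumr_ge0 => x _.
    exact: sumr_ge0.
  by rewrite mulrC; lra.
have BE al : diag_mx (const_mx k + al) - B = M + l%:M + diag_mx al.
  apply/matrixP => i j; rewrite /B /k !mxE.
  by case: (i == j); rewrite ?mulr1n ?mulr0n; ring.
have [Dpos [m mE]] := is_laplace_dominant B0 k0 Bk b0.
have absv0 t i : 0 <= absv (t : rvec R d) i by exact: normr_ge0.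
pose A : 'M[R]_d := - 1%:M.
have DE (th : 'rV[R]_d) : M + l%:M + diag_mx th *m A = M + diag_mx (const_mx l - th).
  by rewrite /A mulmxN mulmx1 raddfB /= diag_const_mx addrA.
have good (th : 'rV[R]_d) : (forall i, th 0 i <= 0) -> 0 < \det (M + l%:M + diag_mx th *m A) /\
    laplace m absv th = (\det (M + l%:M + diag_mx th *m A) `^ (- b))%:E.
  move=> th0; have al0 : nonneg_rv (- th) by move=> i; rewrite mxE oppr_ge0.
  have -> : M + l%:M + diag_mx th *m A = diag_mx (const_mx k + - th) - B.
    by rewrite BE DE raddfB /= diag_const_mx addrA raddfN.
  by split; [exact: Dpos|rewrite -mE// opprK].
(* The tilt by [l] is undone one coordinate at a time. At each stage the matrix is [M] plus a
   nonnegative diagonal, whose determinant is positive, so [laplace_extend] applies. *)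
have Loo : (laplace m absv (const_mx l) < +oo)%E.
  pose th n : 'rV[R]_d := \row_i (l *+ (i < n)%N).
  have -> : const_mx l = th d by apply/rowP => i; rewrite !mxE ltn_ord.
  suff H n : (n <= d)%N -> (laplace m absv (th n) < +oo)%E by exact: H.
  elim: n => [|n IH] nd.
    have [|_ ->] := good (th 0%N); last by rewrite ltry.
    by move=> i; rewrite mxE.
  have thS : th n.+1 = th n + l *: axis R (Ordinal nd).
    apply/rowP => i; rewrite !mxE eqxx /= ltnS leq_eqVlt.
    have -> : (i == Ordinal nd) = (val i == n) by [].
    by case: (ltngtP (val i) n) => // _; rewrite ?mulr0n ?mulr1n ?mulr0 ?mulr1 ?addr0 ?add0r.
  rewrite thS; apply: (laplace_extend (@measurable_absv R d) absv0 b0 good).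
  - exact: IH (ltnW nd).
  - exact: ltW.
  - rewrite DE; apply: Mdet => i; rewrite -thS !mxE.
    by case: (i < n.+1)%N; rewrite ?mulr1n ?mulr0n ?subrr ?subr0 //; exact: ltW.
(* Finiteness at [l] makes the density [e^(l x)] admissible, and weighting by it removes the shift
   [l] from the transform. *)
pose w (f : rvec R d) := expR (\sum_i (const_mx l : 'rV[R]_d) 0 i * absv f i).
have mw : measurable_fun setT w.
  by apply/measurable_EFinP; apply: measurable_expsum; exact: measurable_absv.
have w0 f : 0 <= w f by exact: expR_ge0.
have [m' m'E] := density_measure m mw w0.
apply: (@is_laplace_transfer _ _ _ _ m' absv); [exact: measurable_absv|exact: absv0|].
move=> al al0; rewrite /laplace m'E; last 2 first.
- by apply: measurable_expsum; exact: measurable_absv.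
- by move=> t; rewrite lee_fin expR_ge0.
transitivity (laplace m absv (const_mx l - al)).
  apply: eq_integral => f _; rewrite -EFinM /w -expRD; congr (expR _)%:E.
  by rewrite -big_split; apply: eq_bigr => i _; rewrite !mxE /=; ring.
have [|_ ->] := laplace_finite (@measurable_absv R d) absv0 b0 good (th := const_mx l - al).
  apply: le_lt_trans Loo; apply: laplace_le => //; first exact: measurable_absv.
  by move=> i; rewrite !mxE gerDl oppr_le0.
by rewrite DE subKr.
Qed.

(** * Uniqueness of Laplace transforms *)

Section StepApproximation.
Variable R : realType.

Lemma bernoulli_ineq (q : R) n : 0 <= q <= 1 -> 1 - n%:R * q <= (1 - q) ^+ n.
Proof.
move=> /andP[q0 q1]; elim: n => [|n IH]; first by rewrite expr0 mul0r subr0.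
rewrite exprS; have q10 : 0 <= 1 - q by lra.
have := ler_wpM2l q10 IH; apply: le_trans.
have : 0 <= n%:R * q * q by rewrite !mulr_ge0.
by rewrite -natr1; lra.
Qed.

(* The exponent is of order [n e^(n x)]: large against [e^(n y)] for [y <= x],
   negligible for [y > x]. *)
Definition step_exponent (x : R) (n : nat) : nat :=
  (Num.trunc (n.+1%:R * expR (n.+1%:R * x))).+1.

(** Let [q = e^(-(n+1) y)] and let [K] be the exponent. For [x < y], Bernoulli bounds the error by
    [K q], which is [O(1/n)]. For [y <= x], [K q >= n + 1] and [(1 - q)^K <= e^(-K q)]. *)
Lemma step_approximation (x y : R) : 0 <= x -> 0 <= y ->
  (1 - expR (- (n.+1%:R * y))) ^+ step_exponent x n @[n --> \oo] --> ((x < y)%R%:R : R).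
Proof.
move=> x0 y0.
pose q n := expR (- (n.+1%:R * y)); pose K n := step_exponent x n.
have q01 n : 0 <= q n <= 1.
  by rewrite expR_ge0 -expR0 ler_expR oppr_le0 mulr_ge0.
have Kge n : n.+1%:R * expR (n.+1%:R * x) <= (K n)%:R by rewrite ltW// truncnS_gt.
have Kle n : (K n)%:R <= n.+1%:R * expR (n.+1%:R * x) + 1.
  by rewrite /K /step_exponent -natr1 lerD2r truncn_le// mulr_ge0 ?expR_ge0.
have q10 n : 0 <= 1 - q n <= 1 by have := q01 n; lra.
have [C CP] : exists C, forall n,
    `|(x < y)%R%:R - (1 - q n) ^+ K n| <= C * harmonic n.
  case: ltP => xy /=.
    pose e := y - x; have e0 : 0 < e by rewrite subr_gt0.
    have y1 : 0 < y by apply: le_lt_trans x0 xy.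
    exists (4 / e ^+ 2 + y^-1) => n.
    have H1 : n.+1%:R * expR (- (n.+1%:R * e)) <= 4 / e ^+ 2 * n.+1%:R^-1.
      rewrite expRN ler_pdivrMr ?expR_gt0//.
      have : (n.+1%:R * e / 2) ^+ 2 <= expR (n.+1%:R * e).
        have -> : expR (n.+1%:R * e) = expR (n.+1%:R * e / 2) ^+ 2.
          by rewrite -expRM_natl; congr expR; field.
        apply: lerXn2r; rewrite ?nnegrE ?expR_ge0//.
          by rewrite divr_ge0 ?mulr_ge0 ?ltW.
        by apply: le_trans (expR_ge1Dx _); rewrite lerDr.
      move=> H; have c0 : 0 <= 4 / e ^+ 2 * n.+1%:R^-1.
        by rewrite !mulr_ge0 ?invr_ge0 ?exprn_ge0 ?ltW.
      apply: le_trans (ler_wpM2l c0 H).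
      rewrite le_eqVlt; apply/orP; left; apply/eqP.
      have N0 : n.+1%:R != 0 :> R by rewrite pnatr_eq0.
      have en0 : e != 0 by rewrite gt_eqF.
      by move: (n.+1%:R : R) N0 => N N0; field; rewrite N0 en0.
    have H2 : q n <= y^-1 * n.+1%:R^-1.
      rewrite /q expRN -invfM lef_pV2 ?posrE ?expR_gt0 ?mulr_gt0// mulrC.
      by apply: le_trans (expR_ge1Dx _); rewrite lerDr.
    have B := bernoulli_ineq (K n) (q01 n).
    have U : (1 - q n) ^+ K n <= 1 by have /andP[a b] := q10 n; exact: exprn_ile1.
    have Kq : (K n)%:R * q n <= n.+1%:R * expR (- (n.+1%:R * e)) + q n.
      have /andP[qn0 _] := q01 n; have := ler_wpM2r qn0 (Kle n).
      rewrite mulrDl mul1r /q -mulrA -expRD.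
      by have -> : n.+1%:R * x + - (n.+1%:R * y) = - (n.+1%:R * e) by rewrite /e; ring.
    rewrite ger0_norm ?subr_ge0// /= mulrDl.
    by apply: le_trans (lerD H1 H2); apply: le_trans Kq; rewrite lerBlDr addrC -lerBlDr.
  exists 1 => n; rewrite sub0r normrN mul1r ger0_norm; last first.
    by have /andP[a b] := q10 n; exact: exprn_ge0.
  have H1 : 1 - q n <= expR (- q n) by exact: expR_ge1Dx.
  apply: (@le_trans _ _ (expR (- q n) ^+ K n)).
    by have /andP[a _] := q10 n; apply: lerXn2r; rewrite ?nnegrE ?expR_ge0.
  rewrite -expRM_natl mulrN expRN /= lef_pV2 ?posrE ?expR_gt0//.
  apply: (@le_trans _ _ (1 + n.+1%:R)); first by rewrite lerDr.
  apply: le_trans (expR_ge1Dx _) _; rewrite ler_expR.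
  have /andP[qn0 _] := q01 n; apply: le_trans (ler_wpM2r qn0 (Kge n)).
  rewrite -mulrA ler_peMr// /q -expRD -expR0 ler_expR -mulrBr mulr_ge0// subr_ge0.
  by [].
apply/cvgrPdist_le => e e0; near=> n; apply: le_trans (CP n) _.
near: n.
have : C * harmonic n @[n --> \oo] --> C * 0 by apply: cvgMr; exact: cvg_harmonic.
rewrite mulr0 => /cvgrPdist_le/(_ _ e0).
by apply: filterS => n; rewrite sub0r normrN; apply: le_trans; exact: ler_norm.
Unshelve. all: by end_near. Qed.

End StepApproximation.

Section LaplaceUnique.
Variables (R : realType) (d : nat).
Implicit Types (al : 'rV[R]_d) (g : rvec R d -> R).

Let wint dU (U : measurableType dU) (n : {measure set U -> \bar R})
    (Z : U -> 'I_d -> R) g al :=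
  (\int[n]_t (g (Z t) * expR (\sum_i (- al) 0 i * Z t i))%:E)%E.

Let q (c : R) (i : 'I_d) (f : rvec R d) := expR (- (c * absv f i)).

Let q01 c i f : 0 <= c -> 0 <= q c i f <= 1.
Proof.
by move=> c0; rewrite expR_ge0 -expR0 ler_expR oppr_le0 mulr_ge0// normr_ge0.
Qed.

Let mq c i : measurable_fun setT (q c i).
Proof.
apply: measurableT_comp => //; apply: measurableT_comp => //.
by apply: measurable_funM => //; exact: measurable_absv.
Qed.

Let mcomp dU (U : measurableType dU) (Z : U -> 'I_d -> R) g al :
  random_vector Z -> measurable_fun setT g ->
  measurable_fun setT (fun t => (g (Z t) * expR (\sum_i (- al) 0 i * Z t i))%:E).
Proof.
move=> mZ mg; apply/measurable_EFinP; apply: measurable_funM.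
  exact: (@measurableT_comp _ _ _ _ _ _ g _ (Z : U -> rvec R d) mg (measurable_to_rvec mZ)).
by apply/measurable_EFinP; exact: measurable_expsum.
Qed.

Let exp_le1 (Z : 'I_d -> R) al : nonneg_rv al -> (forall i, 0 <= Z i) ->
  expR (\sum_i (- al) 0 i * Z i) <= 1.
Proof.
move=> al0 Z0; rewrite -expR0 ler_expR; apply: sumr_le0 => i _.
by rewrite mxE mulNr oppr_le0 mulr_ge0.
Qed.

Let wint_fin dU (U : measurableType dU) (n : {measure set U -> \bar R})
    (Z : U -> 'I_d -> R) g al : (n setT < +oo)%E ->
  random_vector Z -> (forall t i, 0 <= Z t i) ->
  measurable_fun setT g -> (forall f, 0 <= g f <= 1) -> nonneg_rv al ->
  wint n Z g al \is a fin_num.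
Proof.
move=> noo mZ Z0 mg g01 al0; have g0 f : 0 <= g f by have /andP[] := g01 f.
rewrite ge0_fin_numE; last first.
  by apply: integral_ge0 => t _; rewrite lee_fin mulr_ge0 ?expR_ge0.
apply: le_lt_trans noo; rewrite -[leRHS]mul1e -integral_cst//.
apply: ge0_le_integral => //.
- by move=> t _; rewrite lee_fin mulr_ge0 ?expR_ge0.
- exact: mcomp.
- move=> t _; rewrite lee_fin mulr_ile1 ?expR_ge0 ?exp_le1//.
  by have /andP[] := g01 (Z t).
Qed.

(** Multiplying the weight by [q c i] only shifts the argument of the transform by [c] along axis
    [i]. *)
Let wint_split dU (U : measurableType dU) (n : {measure set U -> \bar R})
    (Z : U -> 'I_d -> R) g al c i : 0 <= c ->
  random_vector Z -> (forall t i, 0 <= Z t i) ->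
  measurable_fun setT g -> (forall f, 0 <= g f <= 1) ->
  wint n Z g al = (wint n Z (fun f => (g f * (1 - q c i f))%R) al +
                   wint n Z g (al + c *: axis R i)%R)%E.
Proof.
move=> c0 mZ Z0 mg g01; have g0 f : 0 <= g f by have /andP[] := g01 f.
have q0 f : 0 <= 1 - q c i f by have := q01 i f c0; lra.
rewrite /wint -ge0_integralD//.
- apply: eq_integral => t _; rewrite -EFinD; congr EFin.
  have -> : expR (\sum_j (- (al + c *: axis R i)) 0 j * Z t j) =
      q c i (Z t) * expR (\sum_j (- al) 0 j * Z t j).
    rewrite /q -expRD; congr expR.
    under eq_bigr => j _ do rewrite !mxE opprD mulrDl.
    rewrite big_split /= addrC; congr (_ + _).
      rewrite (bigD1 i)//= eqxx mulr1 big1 ?addr0; last first.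
        by move=> j /negPf ->; rewrite mulr0 oppr0 mul0r.
      by rewrite /absv ger0_norm// mulNr.
    by apply: eq_bigr => j _; rewrite !mxE.
  by ring.
- by move=> t _; rewrite lee_fin !mulr_ge0 ?expR_ge0.
- apply: (@mcomp _ U Z (fun f => g f * (1 - q c i f))) => //.
  by apply: measurable_funM => //; apply: measurable_funB => //; exact: mq.
- by move=> t _; rewrite lee_fin mulr_ge0 ?expR_ge0.
- exact: mcomp.
Qed.

Variables (dT dT' : measure_display).
Variables (T : measurableType dT) (T' : measurableType dT').
Variables (m : {measure set T -> \bar R}) (m' : {measure set T' -> \bar R}).
Variables (X : T -> 'I_d -> R) (Y : T' -> 'I_d -> R).
Hypothesis (mX : random_vector X) (mY : random_vector Y).
Hypothesis (X0 : forall t i, 0 <= X t i) (Y0 : forall t i, 0 <= Y t i).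
Hypothesis (moo : (m setT < +oo)%E) (m'oo : (m' setT < +oo)%E).
Hypothesis LE : forall al, nonneg_rv al -> laplace m X (- al) = laplace m' Y (- al).

(** Weights for which the two weighted transforms agree. The class contains [1] and admits
    multiplication by [1 - q c i], hence, by dominated convergence, by indicators of [x < f i]; so
    it contains indicators of orthants. *)
Let test g := [/\ measurable_fun setT g, forall f, 0 <= g f <= 1 &
  forall al, nonneg_rv al -> wint m X g al = wint m' Y g al].

Let test1 : test (fun=> 1).
Proof.
split => //; first by move=> f; rewrite ler01 lexx.
move=> al al0; have := LE al0; rewrite /laplace /wint.
by congr (_ = _); apply: eq_integral => t _; rewrite mul1r.
Qed.

Let test_mulq g c i : 0 <= c -> test g -> test (fun f => g f * (1 - q c i f)).
Proof.
move=> c0 [mg g01 gE].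
have mg' : measurable_fun setT (fun f => g f * (1 - q c i f)).
  by apply: measurable_funM => //; apply: measurable_funB => //; exact: mq.
have g01' f : 0 <= g f * (1 - q c i f) <= 1.
  have /andP[a b] := g01 f; have /andP[a' b'] := q01 i f c0.
  by rewrite mulr_ge0 ?subr_ge0//= mulr_ile1 ?subr_ge0// lerBlDr lerDl.
split => // al al0.
have al0' : nonneg_rv (al + c *: axis R i).
  by move=> j; rewrite !mxE addr_ge0// mulr_ge0.
have := gE _ al0; rewrite (wint_split m al i c0 mX X0 mg g01).
rewrite (wint_split m' al i c0 mY Y0 mg g01) gE// => e.
have fin := wint_fin m'oo mY Y0 mg g01 al0'.
by move/(congr1 (fun z => z - wint m' Y g (al + c *: axis R i)%R)%E): e; rewrite !addeK.
Qed.

Let test_mulqX g c i n : 0 <= c -> test g -> test (fun f => g f * (1 - q c i f) ^+ n).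
Proof.
move=> c0 tg; elim: n => [|n IH].
  by have -> : (fun f => g f * (1 - q c i f) ^+ 0) = g by apply/funext => f; rewrite mulr1.
have -> : (fun f => g f * (1 - q c i f) ^+ n.+1) =
  (fun f => g f * (1 - q c i f) ^+ n * (1 - q c i f)).
  by apply/funext => f; rewrite exprSr mulrA.
exact: test_mulq.
Qed.

Let wint_cvg dU (U : measurableType dU) (n : {measure set U -> \bar R})
    (Z : U -> 'I_d -> R) (g_ : nat -> rvec R d -> R) g al : (n setT < +oo)%E ->
  random_vector Z -> (forall t i, 0 <= Z t i) ->
  (forall k, measurable_fun setT (g_ k)) -> (forall k f, 0 <= g_ k f <= 1) ->
  measurable_fun setT g -> (forall f, g_ k f @[k --> \oo] --> g f) -> nonneg_rv al ->
  (wint n Z (g_ k) al @[k --> \oo] --> wint n Z g al)%E.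
Proof.
move=> noo mZ Z0 mg_ g01 mg cvg al0.
have [//|||||_ _] := @dominated_convergence _ U R n setT measurableT
  (fun k t => (g_ k (Z t) * expR (\sum_i (- al) 0 i * Z t i))%:E)
  (fun t => (g (Z t) * expR (\sum_i (- al) 0 i * Z t i))%:E) (cst 1%E).
- by move=> k; exact: mcomp.
- exact: mcomp.
- apply/aeW => t _; apply: cvg_EFin; first exact: nearW.
  by apply: cvgMl; exact: cvg.
- apply/integrableP; split => //.
  under eq_integral do rewrite /= normr1.
  by rewrite integral_cst// mul1e.
- apply/aeW => t k _; rewrite /= lee_fin.
  have /andP[a b] := g01 k (Z t).
  by rewrite ger0_norm ?mulr_ge0 ?expR_ge0// mulr_ile1 ?expR_ge0 ?exp_le1.
by [].
Qed.

Let test_step g x i : test g -> test (fun f => g f * (x < absv f i)%R%:R).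
Proof.
move=> tg; have [x0|x0] := ltP x 0.
  have -> // : (fun f => g f * (x < absv f i)%R%:R) = g.
  by apply/funext => f; rewrite (lt_le_trans x0) ?mulr1// normr_ge0.
pose g_ k f := g f * (1 - q k.+1%:R i f) ^+ step_exponent x k.
have tg_ k : test (g_ k) by apply: test_mulqX.
have cvg f : g_ k f @[k --> \oo] --> g f * (x < absv f i)%R%:R.
  by apply: cvgMr; apply: step_approximation => //; exact: normr_ge0.
have mg : measurable_fun setT (fun f => g f * (x < absv f i)%R%:R).
  apply: measurable_funM; first by case: tg.
  have -> : (fun f : rvec R d => (x < absv f i)%R%:R) =
      (\1_[set f : rvec R d | x < absv f i] : rvec R d -> R).
    by apply/funext => f; rewrite indicE; congr (nat_of_bool _)%:R; apply/idP/idP; rewrite inE.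
  apply: measurable_indic.
  rewrite -[X in measurable X]setTI.
  by have := @measurable_absv R d i measurableT `]x, +oo[%classic (measurable_itv _);
    congr (measurable (_ `&` _)); apply/seteqP; split => f /=; rewrite in_itv/= andbT.
have g01 f : 0 <= g f * (x < absv f i)%R%:R <= 1.
  by case: tg => _ /(_ f) + _; case: (x < _); rewrite ?mulr1 ?mulr0 ?lexx ?ler01.
split => // al al0.
have tgm k : measurable_fun setT (g_ k) by have [] := tg_ k.
have tg01 k f : 0 <= g_ k f <= 1 by have [_ + _] := tg_ k; apply.
have c1 := wint_cvg moo mX X0 tgm tg01 mg cvg al0.
have c2 := wint_cvg m'oo mY Y0 tgm tg01 mg cvg al0.
have E : (fun k => wint m X (g_ k) al) = (fun k => wint m' Y (g_ k) al).
  by apply/funext => k; have [_ _] := tg_ k; apply.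
rewrite E in c1; have <- := cvg_lim (@ereal_hausdorff R) c1.
exact: (cvg_lim (@ereal_hausdorff R) c2).
Qed.

Let test_orthant (x : 'I_d -> R) (s : seq 'I_d) :
  test (fun f => \prod_(i <- s) (x i < absv f i)%R%:R).
Proof.
elim: s => [|i s IH].
  by have -> : (fun f : rvec R d => \prod_(i <- [::]) (x i < absv f i)%R%:R) = (fun=> 1 : R)
    by apply/funext => f; rewrite big_nil.
have -> : (fun f : rvec R d => \prod_(i <- i :: s) ((x i < absv f i)%R%:R : R)) =
  (fun f => \prod_(i <- s) (x i < absv f i)%R%:R * (x i < absv f i)%R%:R).
  by apply/funext => f; rewrite big_cons mulrC.
exact: test_step.
Qed.

Let orthant_measure dU (U : measurableType dU) (n : {measure set U -> \bar R})
    (Z : U -> 'I_d -> R) (x : 'I_d -> R) :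
  random_vector Z -> (forall t i, 0 <= Z t i) ->
  wint n Z (fun f => \prod_i (x i < absv f i)%R%:R) 0 =
  n [set t | forall i, x i < Z t i].
Proof.
move=> mZ Z0.
have mO : measurable [set t | forall i, x i < Z t i].
  have -> : [set t | forall i, x i < Z t i] =
      \bigcap_(i in [set: 'I_d]) (setT `&` (fun t => Z t i) @^-1` `]x i, +oo[%classic).
    apply/seteqP; split => t /= H i; last by have [_] := H i I; rewrite /= in_itv/= andbT.
    by move=> _; split => //=; rewrite in_itv/= andbT; exact: H.
  by apply: fin_bigcap_measurable => // i _; apply: mZ => //; exact: measurable_itv.
transitivity (\int[n]_t (\1_[set t | forall i, x i < Z t i] t)%:E)%E; last first.
  by rewrite integral_indic// setIT.
apply: eq_integral => t _.
rewrite [X in expR X]big1 ?expR0 ?mulr1; last by move=> i _; rewrite !mxE oppr0 mul0r.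
congr EFin; rewrite indicE; have [H|H] := pselect (forall i, x i < Z t i).
  rewrite mem_set// big1// => i _; by rewrite /absv ger0_norm// H.
rewrite memNset//; apply/eqP; rewrite prodf_seq_eq0; apply/hasP.
move/existsNP: H => [i /negP H]; exists i; first exact: mem_index_enum.
by rewrite /absv ger0_norm// (negPf H) eqxx.
Qed.

Let orthants : set (set (rvec R d)) :=
  [set A | exists x : 'I_d -> R, A = [set f | forall i, x i < f i]].

(** A half-line condition on one coordinate is a countable union of orthants whose other bounds tend
    to minus infinity. *)
Let orthants_generate : @measurable _ (rvec R d) = <<s orthants >>.
Proof.
apply/seteqP; split => A.
  apply: smallest_sub; first exact: smallest_sigma_algebra.
  move=> _ [i [B [mB ->]]].
  pose O : measurableType _ := g_sigma_algebraType orthants.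
  have mi : measurable_fun setT ((fun f => f i) : O -> measurableTypeR R).
    apply: (@measurability _ _ O (measurableTypeR R) setT _ (@RGenOInfty.G R)).
      exact: RGenOInfty.measurableE.
    move=> _ [_ [x ->] <-]; rewrite setTI.
    have -> : (fun f : O => f i) @^-1` `]x, +oo[%classic =
        \bigcup_k [set f : O | forall j, (if j == i then x else - k%:R) < f j].
      apply/seteqP; split => f /=.
        rewrite in_itv/= andbT => xf.
        exists (Num.trunc (\sum_j `|f j|)).+1 => //= j; case: eqP => [->//|_].
        rewrite ltrNl; apply: le_lt_trans (truncnS_gt _).
        rewrite (bigD1 j)//= -(addr0 (- f j)) lerD ?sumr_ge0//.
        by rewrite -normrN ler_norm.
      by move=> [k _ /(_ i)]; rewrite eqxx in_itv/= andbT.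
    apply: bigcupT_measurable => k; apply: sub_sigma_algebra.
    by exists (fun j => if j == i then x else - k%:R).
  by have := mi measurableT B mB; rewrite setTI.
apply: smallest_sub; first exact: sigma_algebra_measurable.
move=> _ [x ->].
have -> : [set f : rvec R d | forall i, x i < f i] =
    \bigcap_(i in [set: 'I_d]) (setT `&` (fun f : rvec R d => f i) @^-1` `]x i, +oo[%classic).
  apply/seteqP; split => t /= H i; last by have [_] := H i I; rewrite /= in_itv/= andbT.
  by move=> _; split => //=; rewrite in_itv/= andbT; exact: H.
apply: fin_bigcap_measurable => // i _.
by apply: measurable_coord => //; exact: measurable_itv.
Qed.

(** Orthants are stable under intersection, generate the sigma-algebra, and exhaust the space, so
    agreement on them suffices. *)
Lemma laplace_unique (A : set ('I_d -> R)) : rvec_borel A ->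
  m (X @^-1` A) = m' (Y @^-1` A).
Proof.
move=> mA.
have mXv := measurable_to_rvec mX; have mYv := measurable_to_rvec mY.
pose p0 : {measure set (rvec R d) -> \bar R} := pushforward m (X : T -> rvec R d).
pose p0' : {measure set (rvec R d) -> \bar R} := pushforward m' (Y : T' -> rvec R d).
pose g k : set (rvec R d) := [set f | forall i, - k%:R < f i].
suff : p0 mXv A = p0' mYv A by [].
apply: (measure_unique orthants g) => //.
- move=> _ _ [x ->] [y ->]; exists (fun i => Num.max (x i) (y i)).
  apply/seteqP; split => f /=.
    by move=> [xf yf] i; rewrite gt_max xf yf.
  by move=> H; split => i; have := H i; rewrite gt_max => /andP[].
- by move=> k; exists (fun=> - k%:R).
- apply/seteqP; split => // f _.
  exists (Num.trunc (\sum_j `|f j|)).+1 => //= j.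
  rewrite ltrNl; apply: le_lt_trans (truncnS_gt _).
  rewrite (bigD1 j)//= -(addr0 (- f j)) lerD ?sumr_ge0//.
  by rewrite -normrN ler_norm.
- move=> _ [x ->]; have [_ _ E] := test_orthant x (index_enum 'I_d).
  have al0 : nonneg_rv (0 : 'rV[R]_d) by move=> i; rewrite mxE.
  by have := E _ al0; rewrite !orthant_measure.
- move=> k; have mg : measurable (g k).
    by rewrite orthants_generate; apply: sub_sigma_algebra; exists (fun=> - k%:R).
  apply: le_lt_trans moo; rewrite [leLHS](_ : _ = m (X @^-1` g k))//.
  apply: le_measure; rewrite ?inE//.
  by have := mXv measurableT _ mg; rewrite setTI.
Qed.

End LaplaceUnique.

(** * Permanental vectors *)

Section ProbabilityOf.
Variables (dT : measure_display) (T : measurableType dT) (R : realType).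
Variable m : {measure set T -> \bar R}.
Hypothesis m1 : m setT = 1%E.

Definition mprob of m setT = 1%E : set T -> \bar R := m.

HB.instance Definition _ := Measure.on (mprob m1).
HB.instance Definition _ := Measure_isProbability.Build _ _ _ (mprob m1) m1.

Lemma probability_of : exists P : probability T R, forall A, P A = m A.
Proof. by exists (mprob m1). Qed.

End ProbabilityOf.

(** Products with one more copy of [Q], by induction. The last clause, multiplicativity of
    transforms, is what identifies the law of the sum. *)
Lemma iid_copies (R : realType) d dT (T : measurableType dT) (Q : probability T R)
    (Z : T -> 'I_d -> R) (k : nat) :
  random_vector Z -> (forall t i, 0 <= Z t i) ->
  exists (dT' : measure_display) (T' : measurableType dT')
         (P : probability T' R) (Y : 'I_k -> T' -> 'I_d -> R),
    [/\ forall j, random_vector (Y j),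
        forall j t i, 0 <= Y j t i,
        independent_vectors P Y,
        forall j, same_law P (Y j) Q Z &
        forall (th : 'rV[R]_d) (c : R), laplace Q Z th = c%:E ->
          laplace P (fun t i => \sum_(j < k) Y j t i) th = (c ^+ k)%:E].
Proof.
move=> mZ Z0; elim: k => [|k [dU [U [P [Y [mY Y0 iY lY LY]]]]]].
  exists dT, T, Q, (fun _ _ _ => 0); split.
  - by case.
  - by case.
  - move=> A _; rewrite big_ord0.
    have -> : \bigcap_(j in [set: 'I_0]) ((fun (_ : T) (_ : 'I_d) => 0 : R) @^-1` A j) = setT.
      by apply/seteqP; split => // t _ [].
    exact: probability_setT.
  - by case.
  - move=> th c _; rewrite expr0 -(probability_setT Q) -(laplace0 Q Z).
    apply: eq_integral => t _; congr (expR _)%:E.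
    by apply: eq_bigr => i _; rewrite big_ord0 mulr0 mxE mul0r.
pose Y' (j : 'I_k.+1) (t : U * T) : 'I_d -> R :=
  if unlift ord0 j is Some i then Y i t.1 else Z t.2.
have Y'0 t : Y' ord0 t = Z t.2 by rewrite /Y' unlift_none.
have Y'S j t : Y' (lift ord0 j) t = Y j t.1 by rewrite /Y' liftK.
have mpre dW (W : measurableType dW) (V : W -> 'I_d -> R) (A : set ('I_d -> R)) :
    random_vector V -> rvec_borel A -> measurable (V @^-1` A).
  by move=> mV mA; have := measurable_to_rvec mV measurableT mA; rewrite setTI.
have mY' j : random_vector (Y' j).
  move=> i; case: (unliftP ord0 j) => [l ->|->].
    under eq_fun do rewrite Y'S.
    exact: (@measurableT_comp _ _ _ _ _ _ (fun t => Y l t i) _ fst (mY l i)).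
  under eq_fun do rewrite Y'0.
  exact: (@measurableT_comp _ _ _ _ _ _ (fun t => Z t i) _ snd (mZ i)).
exists _, (U * T)%type, (P \x Q)%E, Y'; split => //.
- by move=> j t i; case: (unliftP ord0 j) => [l ->|->]; rewrite ?Y'S ?Y'0.
- move=> A mA.
  have -> : \bigcap_(j in [set: 'I_k.+1]) (Y' j @^-1` A j) =
      (\bigcap_(j in [set: 'I_k]) (Y j @^-1` A (lift ord0 j))) `*` (Z @^-1` A ord0).
    apply/seteqP; split => t /=.
      move=> H; split => [j _|]; first by have := H (lift ord0 j) I; rewrite /= Y'S.
      by have := H ord0 I; rewrite /= Y'0.
    move=> [H1 H2] j _ /=; case: (unliftP ord0 j) => [l ->|->]; last by rewrite Y'0.
    by rewrite Y'S; exact: H1.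
  have mB : measurable (\bigcap_(j in [set: 'I_k]) (Y j @^-1` A (lift ord0 j))).
    by apply: fin_bigcap_measurable => // j _; exact: mpre.
  have mC : measurable (Z @^-1` A ord0) by exact: mpre.
  rewrite [LHS]product_measure1E//.
  have iYA := iY (fun j => A (lift ord0 j)) (fun j => mA _).
  transitivity ((\prod_(j < k) P (Y j @^-1` A (lift ord0 j))) * Q (Z @^-1` A ord0))%E.
    by congr (_ * _)%E; exact: iYA.
  rewrite big_ord_recl /= muleC; congr (_ * _)%E.
    have -> : Y' ord0 @^-1` A ord0 = setT `*` (Z @^-1` A ord0).
      by apply/seteqP; split => t /=; rewrite Y'0 // => -[].
    by rewrite [RHS]product_measure1E// [X in (X * _)%E]probability_setT mul1e.
  apply: eq_bigr => j _.
  have -> : Y' (lift ord0 j) @^-1` A (lift ord0 j) = (Y j @^-1` A (lift ord0 j)) `*` setT.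
    by apply/seteqP; split => t /=; rewrite Y'S // => -[].
  have mD : measurable (Y j @^-1` A (lift ord0 j)) by exact: mpre.
  by rewrite [RHS]product_measure1E// [X in (_ * X)%E]probability_setT mule1.
- move=> j A mA; case: (unliftP ord0 j) => [l ->|->].
    have -> : Y' (lift ord0 l) @^-1` A = (Y l @^-1` A) `*` setT.
      by apply/seteqP; split => t /=; rewrite Y'S // => -[].
    have mD : measurable (Y l @^-1` A) by exact: mpre.
    by rewrite [LHS]product_measure1E// [X in (_ * X)%E]probability_setT mule1; exact: lY.
  have -> : Y' ord0 @^-1` A = setT `*` (Z @^-1` A).
    by apply/seteqP; split => t /=; rewrite Y'0 // => -[].
  have mD : measurable (Z @^-1` A) by exact: mpre.
  by rewrite [LHS]product_measure1E// [X in (X * _)%E]probability_setT mul1e.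
- move=> th c Lc; have := LY _ _ Lc.
  set S := (fun (t : U) (i : 'I_d) => _) => LS.
  have mS : random_vector S by move=> i; apply: measurable_sum => j; exact: mY.
  have mS' : random_vector (fun t i => \sum_(j < k.+1) Y' j t i).
    by move=> i; apply: measurable_sum => j; exact: mY'.
  rewrite /laplace fubini_tonelli1//=; last exact: measurable_expsum.
  rewrite /fubini_F.
  transitivity (\int[P]_u ((expR (\sum_i th ord0 i * S u i))%:E * c%:E))%E.
    apply: eq_integral => u _; rewrite -Lc /laplace -ge0_integralZl//; last first.
      exact: measurable_expsum.
    apply: eq_integral => t _; rewrite -EFinM -expRD; congr (expR _)%:E.
    rewrite -big_split; apply: eq_bigr => i _ /=.
    rewrite big_ord_recl Y'0 /= mulrDr addrC; congr (_ * _ + _).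
    by congr (_ * _); rewrite /S; apply: eq_bigr => j _; rewrite Y'S.
  rewrite ge0_integralZr//.
  + by rewrite -/(laplace _ _ _) LS -EFinM exprSr.
  + exact: measurable_expsum.
  + by rewrite -Lc; apply: integral_ge0 => t _; rewrite lee_fin expR_ge0.
Qed.

Section Permanental.
Variables (R : realType) (d : nat) (dT : measure_display) (T : measurableType dT).
Variables (P : probability T R) (psi : T -> 'I_d -> R) (G : 'M[R]_d) (beta : R).
Hypothesis beta0 : 0 < beta.
Hypothesis perm : permanental P psi G beta.

Let permE (al : 'rV[R]_d) : nonneg_rv al ->
  0 < \det (1%:M + diag_mx al *m G) /\
  laplace P (fun t i => 2^-1 * psi t i) (- al) =
    (\det (1%:M + diag_mx al *m G) `^ (- beta))%:E.
Proof.
case: perm => _ _ H al0; have [D0 E] := H al al0; split => //.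
rewrite -E; apply: eq_integral => t _; congr (expR _)%:E.
rewrite mulr_sumr -sumrN; apply: eq_bigr => i _; rewrite mxE; ring.
Qed.

(** The extension results apply with [M = 1] and [A = - G], to the vector [psi / 2]. *)
Lemma permanental_admissible :
  admissible G (fun th => (laplace P (fun t i => (2^-1 * psi t i)%R) th < +oo)%E).
Proof.
case: (perm) => mpsi psi0 _.
have mX i : measurable_fun setT (fun t => 2^-1 * psi t i) by exact: measurable_funM.
have X0 t i : 0 <= 2^-1 * psi t i by rewrite mulr_ge0 ?invr_ge0.
have DE th : 1%:M + diag_mx th *m (- G) = 1%:M - diag_mx th *m G by rewrite mulmxN.
have good (th : 'rV[R]_d) : (forall i, th 0 i <= 0) ->
    0 < \det (1%:M + diag_mx th *m (- G)) /\
    laplace P (fun t i => 2^-1 * psi t i) th =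
      (\det (1%:M + diag_mx th *m (- G)) `^ (- beta))%:E.
  move=> th0; have al0 : nonneg_rv (- th) by move=> i; rewrite mxE oppr_ge0.
  by have := permE al0; rewrite opprK raddfN /= mulNmx mulmxN.
split.
- by have [|_ ->] := good 0; rewrite ?ltry// => i; rewrite mxE.
- by move=> s t Fs ts; apply: le_lt_trans Fs; apply: laplace_le.
- by move=> s /(laplace_finite mX X0 beta0 good)[+ _]; rewrite DE.
- move=> s i u Fs u0 D0; apply: (laplace_extend mX X0 beta0 good) => //.
  by rewrite DE.
Qed.

(** With [M = S G^-1 S] for the signature [S], diagonal matrices commute with [S], so [det(M + diag
    al) = det(1 + diag al G) / det G]. This reduces the claim to [is_laplace_Zmatrix]. *)
Lemma permanental_root (b : R) : (3 < d)%N -> 0 < b -> at_most_one_balanced G ->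
  is_laplace (fun al => \det (1%:M + diag_mx al *m G) `^ (- b)).
Proof.
move=> d3 b0 G1.
have [detG [s sP]] := admissible_inverse_Zmatrix d3 permanental_admissible G1.
have uG : G \in unitmx by rewrite unitmxE unitfE gt_eqF.
pose S : 'M[R]_d := diag_mx (\row_i (-1) ^+ s i).
pose M : 'M[R]_d := S *m invmx G *m S.
have ME i j : M i j = (-1) ^+ s i * invmx G i j * (-1) ^+ s j.
  by rewrite /M /S mul_mx_diag mul_diag_mx !mxE.
have SS : S *m S = 1%:M.
  apply/matrixP => i j; rewrite mul_diag_mx !mxE.
  by case: eqP => [->|_]; rewrite ?mulr0n ?mulr0// !mulr1n -expr2 sqrr_sign.
have detM al : \det (M + diag_mx al) = (\det G)^-1 * \det (1%:M + diag_mx al *m G).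
  have -> : M + diag_mx al = S *m (invmx G + diag_mx al) *m S.
    rewrite mulmxDr mulmxDl; congr (_ + _).
    apply/matrixP => i j; rewrite mul_mx_diag mul_diag_mx !mxE.
    case: eqP => [->|_]; last by rewrite !mulr0n mulr0 mul0r.
    by rewrite !mulr1n mulrAC -expr2 sqrr_sign mul1r.
  have -> : invmx G + diag_mx al = (1%:M + diag_mx al *m G) *m invmx G.
    by rewrite mulmxDl mul1mx mulmxK.
  rewrite !det_mulmx det_inv mulrAC -det_mulmx SS det1 mul1r.
  by rewrite mulrC.
have Mpos al : nonneg_rv al -> 0 < \det (M + diag_mx al).
  by move=> al0; rewrite detM mulr_gt0 ?invr_gt0//; have [] := permE al0.
have Moff i j : i != j -> M i j <= 0 by move=> ij; rewrite ME sP.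
have := is_laplaceZ (powR_ge0 (\det G) (- b)) (is_laplace_Zmatrix b0 Moff Mpos).
apply: eq_is_laplace => al al0; have [D0 _] := permE al0.
rewrite detM -powRM ?ltW ?mulr_gt0 ?invr_gt0// mulrA divff ?mul1r// gt_eqF//.
Qed.

Lemma permanental_infinitely_divisible : (3 < d)%N -> at_most_one_balanced G ->
  infinitely_divisible P psi.
Proof.
move=> d3 G1 k k0.
case: (perm) => mpsi psi0 _.
have kR : 0 < k%:R :> R by rewrite ltr0n.
have [nu nuE] := permanental_root d3 (divr_gt0 beta0 kR) G1.
have nu1 : nu setT = 1%E.
  rewrite -(laplace0 nu absv) -oppr0 nuE; last by move=> i; rewrite mxE.
  by rewrite raddf0 mul0mx addr0 det1 powR1.
have [Q QE] := probability_of nu1.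
(* The root is built for [psi / 2]; the factor [2] returns to [psi], and reappears below as the
   argument [2 *: al]. *)
pose Z (f : rvec R d) (i : 'I_d) : R := 2 * absv f i.
have mZ : random_vector Z.
  by move=> i; apply: measurable_funM => //; exact: measurable_absv.
have Z0 t i : 0 <= Z t i by rewrite mulr_ge0// normr_ge0.
have [dU [U [P' [Y [mY Y0 iY lY LY]]]]] := iid_copies Q k mZ Z0.
exists dU, U, P', Y; split => //.
  by move=> j j' A mA; rewrite (lY j A mA) (lY j' A mA).
move=> A mA; apply: laplace_unique => //.
- by move=> i; apply: measurable_sum => j; exact: mY.
- by move=> t i; apply: sumr_ge0.
- by rewrite [X in (X < _)%E]probability_setT ltry.
- by rewrite [X in (X < _)%E]probability_setT ltry.
move=> al al0.
have al2 : nonneg_rv (2 *: al) by move=> i; rewrite mxE mulr_ge0.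
have [D0 psiE] := permE al2.
rewrite (LY _ (\det (1%:M + diag_mx (2 *: al) *m G) `^ (- (beta / k%:R)))); last first.
  rewrite -nuE// /laplace (@eq_measure_integral _ _ _ _ nu).
    apply: eq_integral => f _; congr (expR _)%:E.
    by apply: eq_bigr => i _; rewrite /Z !mxE; ring.
  by move=> B _ _; exact: QE.
transitivity (laplace P (fun t i => 2^-1 * psi t i) (- (2 *: al))).
  rewrite psiE -powR_mulrn ?powR_ge0// -powRrM; congr (_ `^ _)%:E.
  by rewrite mulNr divfK// gt_eqF.
apply: eq_integral => t _; congr (expR _)%:E.
by apply: eq_bigr => i _; rewrite !mxE; field.
Qed.

End Permanental.

Theorem theorem1p1 (R : realType) (d : nat) (dT : measure_display)
  (T : measurableType dT) (P : probability T R) (psi : T -> 'I_d -> R)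
  (G : 'M[R]_d) (beta : R) :
  (3 < d)%N -> 0 < beta ->
  permanental P psi G beta ->
  (forall I J : {set 'I_d}, #|I| = 3%N -> #|J| = 3%N ->
     symmetrizable (principal_submx G I) ->
     symmetrizable (principal_submx G J) -> I = J) ->
  infinitely_divisible P psi.
Proof.
move=> d3 beta0 perm H; apply: (permanental_infinitely_divisible beta0 perm) => //.
exact: at_most_one_balanced_of_symmetrizable (permanental_admissible beta0 perm) H.
Qed.
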